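(* Let $V$ be a finite nonempty set with $n=|V|$, and let $f:2^V\to\mathbb{Z}$ be an integer valued submodular function with $f(\emptyset)=0$, given by an evaluation oracle. Then the algorithm Rescaling-SFM (described in the context) finds an optimal solution to $\min_{S\subseteq V} f(S)$, i.e. it returns a set $W\subseteq V$ with $f(W)=\min_{S\subseteq V}f(S)$, in time $$O\big((n^4\cdot \mathrm{EO}+n^5)\log(nL_{f,2})\big),$$ where $L_{f,2}=\max\{\|z\|_2 : z\in B(f)\}$.
   Context: A function $f:2^V\to\mathbb{R}$ is submodular if $f(X)+f(Y)\ge f(X\cap Y)+f(X\cup Y)$ for all $X,Y\subseteq V$. $\mathrm{EO}$ is the time of one oracle query for $f(S)$; running time counts arithmetic operations on numbers plus $\mathrm{EO}$ per query. For $z\in\mathbb{R}^V$ and $S\subseteq V$, $z(S)=\sum_{v\in S}z(v)$. The base polytope is $B(f)=\{x\in\mathbb{R}^V: x(S)\le f(S)\ \forall S\subseteq V,\ x(V)=f(V)\}$. For $Q$ symmetric positive definite, $\langle x,y\rangle_Q=x^{\top}Qy$ and $\|x\|_Q=\sqrt{\langle x,x\rangle_Q}$. The quantity $L_{f,2}$ is assumed known to the algorithm. Arguments of $\log$ are read as at least $2$, and $g/\|g\|_Q$ is read as $0$ if $g=0$. Greedy routine. $\mathrm{GreedyMin}(h,w)$, for $h$ submodular with $h(\emptyset)=0$ and $w\in\mathbb{R}^V$: order $V$ so that $w(v_1)\le\dots\le w(v_n)$ and return the point $x$ with $x(v_i)=h(\{v_1,\dots,v_i\})-h(\{v_1,\dots,v_{i-1}\})$;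 it minimizes $w^{\top}x$ over $B(h)$. $\mathrm{MinSet}(h,w)$ returns a set minimizing $h$ among $\emptyset$ and the prefixes $\{v_1,\dots,v_i\}$, $i=1,\dots,n$, of that ordering. Shifted function. For $\mu\ge\max\{0,-f(V)\}$, $f_\mu(S)=0$ if $S\in\{\emptyset,V\}$ and $f_\mu(S)=f(S)+\mu$ otherwise. Sliding von Neumann$(f,\mu,W,Q,\varepsilon)$, where $f(W)=-\mu$: set $\mu':=\mu$, $W':=W$; pick an arbitrary vertex $g_1$ of $B(f_\mu)$; set $x_1:=1$, $y:=g_1/\|g_1\|_Q$, $k:=2$. While $\|y\|_Q>\varepsilon$: let $g_k:=\mathrm{GreedyMin}(f_{\mu'},Qy)$; if $y^{\top}Qg_k>0$, then set $W':=\mathrm{MinSet}(f_{\mu'},Qy)$, $\delta:=-f_{\mu'}(W')$, then $\mu':=-f(W')$, and, with $v_1,v_n$ the first and last elements of the ordering by increasing $Qy$, set $g_k(v_1):=g_k(v_1)+\delta$, $g_k(v_n):=g_k(v_n)-\delta$; then (in all cases) set $\lambda:=\langle y-g_k/\|g_k\|_Q,\,y\rangle_Q/\|y-g_k/\|g_k\|_Q\|_Q^2$, $y:=(1-\lambda)y+\lambda g_k/\|g_k\|_Q$, $x_k:=\lambda$, $x_i:=(1-\lambda)x_i$ for $i<k$, $k:=k+1$. Return $\mu',W'$, the generated vectors $g_1,\dots,g_k$ (re-indexed so that $k$ is their number), $x$, $y$. Rescaling-SFM. Set $\varepsilon:=1/(20n)$, $T:=5n\log(nL_{f,2})$, $Q:=R:=I_n$,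 $\Gamma:=\emptyset$, $\mu:=\max\{0,-f(V)\}$; $W:=V$ if $f(V)<0$, else $W:=\emptyset$. For $i=1,\dots,T$: call Sliding von Neumann$(f,\mu,W,Q,\varepsilon)$ to obtain the new $\mu$ and $W$ and vectors $g_1,\dots,g_k,x,y$; if $y=0$ stop and return $W$; otherwise rescale: $R:=\frac{1}{(1+\varepsilon)^2}\big(R+\sum_{i=1}^k\frac{x_i}{\|g_i\|_Q^2}g_ig_i^{\top}\big)$, $Q:=R^{-1}$, and set $\Gamma:=\Gamma\cup\{g_1,\dots,g_k\}$. Finally return $W$. *)

(* Defs.v *)
From HB Require Import structures.
From mathcomp Require Import all_boot all_order all_algebra.
From mathcomp Require Import reals exp.
From mathcomp Require Import ring lra.

Set Implicit Arguments.
Unset Strict Implicit.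
Unset Printing Implicit Defensive.

Import Order.TTheory GRing.Theory Num.Theory.
Local Open Scope ring_scope.

(** * Submodular functions and base polytopes *)

Definition submodular (V : finType) (R : numDomainType) (f : {set V} -> R) :=
  forall X Y : {set V}, f (X :&: Y) + f (X :|: Y) <= f X + f Y.

Definition base_polytope (V : finType) (R : numDomainType) (f : {set V} -> R)
    (x : {ffun V -> R}) :=
  (forall S : {set V}, \sum_(v in S) x v <= f S) /\
  \sum_v x v = f [set: V].

Definition norm2 (V : finType) (R : rcfType) (x : {ffun V -> R}) : R :=
  Num.sqrt (\sum_v x v ^+ 2).

(* L = max {||z||_2 : z in B(f)}, the maximum being attained *)
Definition is_max_norm2 (V : finType) (R : rcfType) (f : {set V} -> R) (L : R) :=
  (exists2 z, base_polytope f z & norm2 z = L) /\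
  (forall z, base_polytope f z -> norm2 z <= L).

(* Binary logarithm, with arguments below 2 read as 2. *)
Definition log2 (R : realType) (x : R) : R := ln (Num.max 2 x) / ln 2.

(** * Real-number programs with an evaluation oracle *)

(* The type [num] of numbers is abstract in programs, so that a program can
   only build or inspect a number through [Compute], [Leq] and [Query], which
   are the steps that are charged for in [always] below. *)
Inductive operation (num : Type) : Type :=
| Const of nat
| Add of num & num
| Sub of num & num
| Mul of num & num
| Div of num & num
| Sqrt of num.

Arguments Const {num}.

(* [PickOrder] and [Flip] are the arbitrary choices left open by the algorithm
   (an arbitrary ordering of V, resp. an arbitrary bit).  [OutOfFuel] marks a
   while loop that has been unrolled fewer times than needed. *)
Inductive prog (num : Type) (V : finType) (A : Type) : Type :=
| Ret of A
| Compute of operation num & (num -> prog num V A)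
| Leq of num & num & (bool -> prog num V A)
| Query of {set V} & (num -> prog num V A)
| PickOrder of (seq V -> prog num V A)
| Flip of (bool -> prog num V A)
| OutOfFuel.

Arguments Ret {num V A}.
Arguments OutOfFuel {num V A}.

Fixpoint bind num V A B (p : prog num V A) (k : A -> prog num V B)
    : prog num V B :=
  match p with
  | Ret a => k a
  | Compute o c => Compute o (fun x => bind (c x) k)
  | Leq x y c => Leq x y (fun b => bind (c b) k)
  | Query X c => Query X (fun x => bind (c x) k)
  | PickOrder c => PickOrder (fun s => bind (c s) k)
  | Flip c => Flip (fun b => bind (c b) k)
  | OutOfFuel => OutOfFuel
  end.

Notation "'let!' x := p 'in' q" := (bind p (fun x => q))
  (at level 200, x name, p at level 100, q at level 200).
Notation "'let!' ' x := p 'in' q" := (bind p (fun x => q))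
  (at level 200, x strict pattern, p at level 100, q at level 200).

Definition eval (R : rcfType) (o : operation R) : R :=
  match o with
  | Const m => m%:R
  | Add x y => x + y
  | Sub x y => x - y
  | Mul x y => x * y
  | Div x y => x / y
  | Sqrt x => Num.sqrt x
  end.

(* [always f p P]: when queries are answered by f, every execution of p
   (whatever the arbitrary choices) runs to completion without exhausting its
   fuel, and P a t q holds of its result a, its number t of arithmetic
   operations and comparisons and its number q of oracle queries. *)
Fixpoint always (R : rcfType) (V : finType) (f : {set V} -> R) A
    (p : prog R V A) (P : A -> nat -> nat -> Prop) : Prop :=
  match p with
  | Ret a => P a 0%N 0%N
  | Compute o k => always f (k (eval o)) (fun a t q => P a t.+1 q)
  | Leq x y k => always f (k (x <= y)) (fun a t q => P a t.+1 q)
  | Query X k => always f (k (f X)) (fun a t q => P a t q.+1)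
  | PickOrder k => forall s, perm_eq s (enum V) -> always f (k s) P
  | Flip k => forall b, always f (k b) P
  | OutOfFuel => False
  end.

(** * The algorithm *)

Section Algorithm.
Variables (num : Type) (V : finType).

Local Notation prog := (prog num V).
Local Notation vec := {ffun V -> num}.
Local Notation mat := {ffun V * V -> num}.

Definition compute (o : operation num) : prog num := Compute o Ret.
Definition const (m : nat) : prog num := compute (Const m).
Definition add x y : prog num := compute (Add x y).
Definition sub x y : prog num := compute (Sub x y).
Definition mul x y : prog num := compute (Mul x y).
Definition div x y : prog num := compute (Div x y).
Definition sqrt x : prog num := compute (Sqrt x).
Definition leq x y : prog bool := Leq x y Ret.
Definition query (S : {set V}) : prog num := Query S Ret.
Definition pick_order : prog (seq V) := PickOrder Ret.
Definition flip : prog bool := Flip Ret.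

Fixpoint foldM I B (F : B -> I -> prog B) (b : B) (s : seq I) : prog B :=
  if s is i :: s' then let! b' := F b i in foldM F b' s' else Ret b.

Definition upd (I : finType) (x : {ffun I -> num}) (i : I) (a : num) :=
  [ffun j => if j == i then a else x j].

Definition tabulate (I : finType) (F : I -> prog num) : prog {ffun I -> num} :=
  let! zero := const 0 in
  foldM (fun x i => let! a := F i in Ret (upd x i a)) [ffun=> zero] (enum I).

(** Linear algebra *)

Definition dot (x y : vec) : prog num :=
  let! zero := const 0 in
  foldM (fun a v => let! b := mul (x v) (y v) in add a b) zero (enum V).

Definition mulmv (M : mat) (x : vec) : prog vec :=
  tabulate (fun u => dot [ffun v => M (u, v)] x).

Definition inner (Q : mat) (x y : vec) : prog num :=
  let! z := mulmv Q y in dot x z.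

Definition normQ (Q : mat) (x : vec) : prog num :=
  let! a := inner Q x x in sqrt a.

(* g / ||g||_Q, which is 0 if g = 0 since x / 0 = 0 in [eval] *)
Definition normalize (Q : mat) (g : vec) : prog vec :=
  let! a := normQ Q g in tabulate (fun v => div (g v) a).

Definition identity : prog mat :=
  tabulate (fun uv => const (uv.1 == uv.2)).

(* One exchange step: if M represents y = M x, then [pivot M k] represents the
   same relation solved for x_k instead of y_k.  Pivoting once on every index
   inverts M in place (Gauss-Jordan); no pivot vanishes if M is positive
   definite. *)
Definition pivot (M : mat) (k : V) : prog mat :=
  tabulate (fun uv => let: (u, v) := uv in
    if (u == k) && (v == k) then let! one := const 1 in div one (M (k, k))
    else if u == k then
      let! a := div (M (k, v)) (M (k, k)) in let! zero := const 0 in sub zero a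
    else if v == k then div (M (u, k)) (M (k, k))
    else let! a := mul (M (u, k)) (M (k, v)) in
         let! b := div a (M (k, k)) in sub (M (u, v)) b).

Definition inverse (M : mat) : prog mat := foldM pivot M (enum V).

(** The greedy routine *)

Fixpoint insert_by (w : vec) (v : V) (s : seq V) : prog (seq V) :=
  if s is u :: s' then
    let! b := leq (w v) (w u) in
    if b then Ret (v :: s) else let! r := insert_by w v s' in Ret (u :: r)
  else Ret [:: v].

Fixpoint sort_by (w : vec) (s : seq V) : prog (seq V) :=
  if s is v :: s' then let! r := sort_by w s' in insert_by w v r else Ret [::].

(* An ordering of V by increasing w.  The sort is stable and starts from an
   arbitrary ordering, so that ties are broken in an arbitrary way. *)
Definition order_by (w : vec) : prog (seq V) :=
  let! s := pick_order in sort_by w s.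

(* The routines below take the ordering v_1, ..., v_n as an argument, because
   one iteration of the sliding algorithm uses a single ordering for GreedyMin,
   MinSet and the pair v_1, v_n. *)
Fixpoint greedy_from (h : {set V} -> prog num) (x : vec) (P : {set V})
    (hP : num) (s : seq V) : prog vec :=
  if s is v :: s' then
    let! hv := h (v |: P) in
    let! d := sub hv hP in
    greedy_from h (upd x v d) (v |: P) hv s'
  else Ret x.

Definition greedy_min (h : {set V} -> prog num) (s : seq V) : prog vec :=
  let! zero := const 0 in
  let! h0 := h set0 in
  greedy_from h [ffun=> zero] set0 h0 s.

(* B is the best prefix so far; [flip] decides between equally good ones. *)
Fixpoint min_set_from (h : {set V} -> prog num) (B : {set V}) (hB : num)
    (P : {set V}) (s : seq V) : prog {set V} :=
  if s is v :: s' then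
    let! hv := h (v |: P) in
    let! le := leq hv hB in
    let! ge := leq hB hv in
    let! tie := flip in
    if le && (~~ ge || tie) then min_set_from h (v |: P) hv (v |: P) s'
    else min_set_from h B hB (v |: P) s'
  else Ret B.

Definition min_set (h : {set V} -> prog num) (s : seq V) : prog {set V} :=
  let! h0 := h set0 in min_set_from h set0 h0 set0 s.

(* The vertices of B(h) are the greedy points of the orderings of V, see
   [vertexP] and [always_pick_vertex] below. *)
Definition pick_vertex (h : {set V} -> prog num) : prog vec :=
  let! s := pick_order in greedy_min h s.

(** Sliding von Neumann *)

(* The shifted function f_mu *)
Definition shifted (mu : num) (S : {set V}) : prog num :=
  if (S == set0) || (S == [set: V]) then const 0
  else let! a := query S in add a mu.

(* [gens] lists the pairs (g_i, x_i) in order of creation. *)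
Record svn_state : Type := SvnState {
  svn_mu : num; svn_W : {set V}; svn_gens : seq (vec * num); svn_y : vec }.

(* The change of mu' and W', and the update of g_k *)
Definition slide (mu : num) (s : seq V) (g : vec)
    : prog (num * {set V} * vec) :=
  let! zero := const 0 in
  let! W := min_set (shifted mu) s in
  let! a := shifted mu W in
  let! delta := sub zero a in
  let! b := query W in
  let! mu' := sub zero b in
  if s is v1 :: s' then
    let vn := last v1 s' in
    let! a1 := add (g v1) delta in
    let g1 := upd g v1 a1 in
    let! an := sub (g1 vn) delta in
    Ret (mu', W, upd g1 vn an)
  else Ret (mu', W, g).

Definition svn_step (Q : mat) (st : svn_state) : prog svn_state :=
  let: SvnState mu W gens y := st in
  let! w := mulmv Q y in
  let! s := order_by w in
  let! g := greedy_min (shifted mu) s in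
  let! yQg := inner Q y g in
  let! zero := const 0 in
  let! nonpos := leq yQg zero in
  let! '(mu', W', g') :=
    (if nonpos then Ret (mu, W, g) else slide mu s g) in
  let! u := normalize Q g' in
  let! d := tabulate (fun v => sub (y v) (u v)) in
  let! a := inner Q d y in
  let! b := inner Q d d in
  let! lambda := div a b in
  let! one := const 1 in
  let! colambda := sub one lambda in
  let! y' := tabulate (fun v =>
    let! a := mul colambda (y v) in
    let! b := mul lambda (u v) in add a b) in
  let! gens' := foldM (fun r gx =>
    let! x := mul colambda gx.2 in Ret (rcons r (gx.1, x))) [::] gens in
  Ret (SvnState mu' W' (rcons gens' (g', lambda)) y').

Fixpoint svn_loop (fuel : nat) (Q : mat) (eps : num) (st : svn_state)
    : prog svn_state :=
  let! ny := normQ Q (svn_y st) in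
  let! small := leq ny eps in
  if small then Ret st
  else if fuel is m.+1 then
    let! st' := svn_step Q st in svn_loop m Q eps st'
  else OutOfFuel.

Definition sliding_von_neumann (fuel : nat) (mu : num) (W : {set V}) (Q : mat)
    (eps : num) : prog svn_state :=
  let! g := pick_vertex (shifted mu) in
  let! y := normalize Q g in
  let! one := const 1 in
  svn_loop fuel Q eps (SvnState mu W [:: (g, one)] y).

(** Rescaling-SFM *)

Definition is_zero (y : vec) : prog bool :=
  let! zero := const 0 in
  foldM (fun r v => let! le := leq (y v) zero in
                    let! ge := leq zero (y v) in Ret [&& r, le & ge])
    true (enum V).

(* The new value of R = Q^-1 *)
Definition rescale (eps : num) (Q R : mat) (gens : seq (vec * num))
    : prog mat :=
  let! M := foldM (fun (M : mat) gx =>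
    let: (g, x) := gx in
    let! a := inner Q g g in
    let! c := div x a in
    tabulate (fun uv : V * V =>
      let! p := mul (g uv.1) (g uv.2) in
      let! r := mul c p in add (M uv) r)) R gens in
  let! one := const 1 in
  let! b := add one eps in
  let! b2 := mul b b in
  let! c := div one b2 in
  tabulate (fun uv => mul c (M uv)).

Fixpoint rescaling_loop (fuel T : nat) (eps : num) (Q R : mat)
    (Gamma : seq vec) (mu : num) (W : {set V}) : prog {set V} :=
  if T is T'.+1 then
    let! '(SvnState mu' W' gens y) := sliding_von_neumann fuel mu W Q eps in
    let! stop := is_zero y in
    if stop then Ret W' else
    let! R' := rescale eps Q R gens in
    let! Q' := inverse R' in
    rescaling_loop fuel T' eps Q' R' (Gamma ++ [seq gx.1 | gx <- gens]) mu' W'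
  else Ret W.

(* [fuel] bounds the number of iterations of each while loop. *)
Definition rescaling_sfm (fuel T : nat) : prog {set V} :=
  let! one := const 1 in
  let! d := const (20 * #|V|) in
  let! eps := div one d in
  let! Q := identity in
  let! zero := const 0 in
  let! fV := query [set: V] in
  let! nonneg := leq zero fV in
  let! opp := sub zero fV in
  let mu := if nonneg then zero else opp in
  let W := if nonneg then set0 else [set: V] in
  rescaling_loop fuel T eps Q Q [::] mu W.

End Algorithm.

(* The number of iterations of "for i = 1, ..., T", T = 5 n log(n L) *)
Definition rounds (R : realType) (n : nat) (L : R) : nat :=
  Num.truncn (5 * n%:R * log2 (n%:R * L)).

(** * Vertices of the base polytope and the greedy routine *)

Section Vertices.
Variables (V : finType) (R : realFieldType) (f : {set V} -> R).
Hypothesis fsub : submodular f.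
Hypothesis f0 : f set0 = 0.

Definition vertex (x : {ffun V -> R}) :=
  base_polytope f x /\
  forall a b, base_polytope f a -> base_polytope f b ->
    (forall v, a v + b v = x v *+ 2) -> a = x.

Definition greedy_point (s : seq V) : {ffun V -> R} :=
  [ffun v => f [set u in take (index v s).+1 s] - f [set u in take (index v s) s]].

Lemma sum_add1 (x : {ffun V -> R}) v (P : {set V}) : v \notin P ->
  \sum_(u in v |: P) x u = x v + \sum_(u in P) x u.
Proof. by move=> vP; rewrite big_setU1. Qed.

Lemma take_indexS (s : seq V) v : v \in s ->
  take (index v s).+1 s = rcons (take (index v s) s) v.
Proof. by move=> vs; rewrite (take_nth v) ?index_mem // nth_index. Qed.

Lemma set_takeS (s : seq V) v : v \in s ->
  [set u in take (index v s).+1 s] = v |: [set u in take (index v s) s].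
Proof.
by move=> vs; rewrite take_indexS //; apply/setP=> u; rewrite !inE mem_rcons inE.
Qed.

Lemma notin_take_index (s : seq V) v : uniq s -> v \in s ->
  v \notin take (index v s) s.
Proof.
move=> us vs; have := take_uniq (index v s).+1 us.
by rewrite take_indexS // rcons_uniq => /andP[].
Qed.

Lemma prefixes_tight_eq s (x : {ffun V -> R}) : uniq s -> (forall v, v \in s) ->
  (forall j, \sum_(u in [set u in take j s]) x u = f [set u in take j s]) ->
  x = greedy_point s.
Proof.
move=> us sV xt; apply/ffunP=> v; rewrite ffunE -!xt set_takeS //.
by rewrite sum_add1 ?addrK // inE notin_take_index.
Qed.

Lemma greedy_prefix s j : uniq s -> (forall v, v \in s) ->
  \sum_(u in [set u in take j s]) greedy_point s u = f [set u in take j s].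
Proof.
move=> us sV; elim: j => [|j IH].
  rewrite take0; have -> : [set u in Nil V] = set0 by apply/setP=> u; rewrite !inE.
  by rewrite big_set0 f0.
have [js|js] := ltnP j (size s); last first.
  by move: IH; rewrite !take_oversize // (leq_trans js).
have [v0 _] : exists v0 : V, true by case: (s) js => // v0; exists v0.
set v := nth v0 s j.
have ij : index v s = j by rewrite index_uniq.
have -> : [set u in take j.+1 s] = v |: [set u in take j s].
  by rewrite -ij set_takeS.
rewrite sum_add1; last by rewrite inE -ij notin_take_index.
by rewrite IH ffunE ij subrK -ij set_takeS.
Qed.

Lemma greedy_base s : uniq s -> (forall v, v \in s) ->
  base_polytope f (greedy_point s).
Proof.
move=> us sV; have sT : [set u in take (size s) s] = setT.
  by apply/setP=> u; rewrite take_size !inE sV.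
split; last first.
  have := greedy_prefix (size s) us sV; rewrite sT => <-.
  by apply: eq_bigl => v; rewrite inE.
move=> S; rewrite -[S]setIT -sT; elim: (size s) => [|j IH].
  rewrite take0; have -> : [set u in Nil V] = set0 by apply/setP=> u; rewrite !inE.
  by rewrite setI0 big_set0 f0.
have [js|js] := ltnP j (size s); last first.
  by move: IH; rewrite !take_oversize // (leq_trans js).
have [v0 _] : exists v0 : V, true by case: (s) js => // v0; exists v0.
set v := nth v0 s j.
have ij : index v s = j by rewrite index_uniq.
have vP : v \notin [set u in take j s] by rewrite inE -ij notin_take_index.
have Pj : [set u in take j.+1 s] = v |: [set u in take j s].
  by rewrite -ij set_takeS.
have [vS|vS] := boolP (v \in S); last first.
  suff -> : S :&: [set u in take j.+1 s] = S :&: [set u in take j s] by [].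
  rewrite Pj; apply/setP=> u; rewrite !inE; case: eqP => [->|//].
  by rewrite (negbTE vS).
have E : S :&: [set u in take j.+1 s] = v |: (S :&: [set u in take j s]).
  by rewrite Pj setIUr; congr (_ :|: _); apply/setIidPr; rewrite sub1set vS.
rewrite E sum_add1; last by rewrite inE (negbTE vP) andbF.
have := fsub (S :&: [set u in take j.+1 s]) [set u in take j s].
have -> : S :&: [set u in take j.+1 s] :&: [set u in take j s] =
          S :&: [set u in take j s].
  by by rewrite Pj -setIA; congr (_ :&: _); apply/setIidPr; exact: subsetUr.
have -> : S :&: [set u in take j.+1 s] :|: [set u in take j s] =
          [set u in take j.+1 s].
  apply/setP=> u; rewrite Pj !inE; case: eqP => [->|_] /=; first by rewrite vS.
  by case: (u \in take j s); rewrite ?orbT ?andbF ?andbT.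
rewrite E.
have -> : greedy_point s v = f [set u in take j.+1 s] - f [set u in take j s].
  by rewrite ffunE ij.
by move: IH; lra.
Qed.

Lemma greedy_vertex s : uniq s -> (forall v, v \in s) -> vertex (greedy_point s).
Proof.
move=> us sV; split=> [|a b [aS _] [bS _] abx]; first exact: greedy_base.
apply: prefixes_tight_eq => // j; set P := [set u in take j s].
have : \sum_(v in P) a v + \sum_(v in P) b v = f P *+ 2.
  rewrite -(greedy_prefix j us sV) -sumrMnl -big_split /=.
  by apply: eq_bigr => v _; exact: abx.
by have := aS P; have := bS P; lra.
Qed.

Section Converse.
Variable x : {ffun V -> R}.
Hypothesis xV : vertex x.
Let tight (S : {set V}) := \sum_(v in S) x v == f S.

Let tightT : tight setT.
Proof.
case: xV => -[_ E] _; apply/eqP; rewrite -E.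
by apply: eq_bigl => v; rewrite inE.
Qed.

Let tight0 : tight set0. Proof. by rewrite /tight big_set0 f0. Qed.

Let sumUI (A B : {set V}) : \sum_(v in A) x v + \sum_(v in B) x v =
  \sum_(v in A :&: B) x v + \sum_(v in A :|: B) x v.
Proof.
have E (C : {set V}) : \sum_(v in C) x v = \sum_v (if v \in C then x v else 0).
  by rewrite big_mkcond.
rewrite !E -!big_split; apply: eq_bigr => v _; rewrite !inE.
by case: (v \in A); case: (v \in B) => /=; ring.
Qed.

Let tightUI A B : tight A -> tight B -> tight (A :&: B) && tight (A :|: B).
Proof.
case: xV => -[xS _] _ /eqP tA /eqP tB; have := sumUI A B; have := fsub A B.
have := xS (A :&: B); have := xS (A :|: B); rewrite tA tB => h1 h2 h3 h4.
by apply/andP; split; apply/eqP; move: h1 h2 h3 h4; lra.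
Qed.

Let separated u v : u != v -> exists2 S, tight S & (u \in S) != (v \in S).
Proof.
move=> uv; have [/exists_inP[S]|] :=
  boolP [exists S : {set V} in tight, (u \in S) != (v \in S)].
  by exists S.
rewrite negb_exists => /forallP nsep.
have [e e0 eP] : exists2 e : R, 0 < e &
    forall S, ~~ tight S -> e <= f S - \sum_(v in S) x v.
  exists (\big[Num.min/1]_(S : {set V} | ~~ tight S) (f S - \sum_(v in S) x v)).
    elim/big_ind: _ => [|y z|S nS]; first exact: ltr01.
      by move=> y0 z0; rewrite lt_min y0.
    by case: xV => -[xS _] _; rewrite subr_gt0 lt_neqAle nS xS.
  by move=> S nS; apply: (bigmin_le_cond _ (fun S => f S - \sum_(v in S) x v) nS).
have [[xS xT] xE] := xV.
pose d (c : R) : {ffun V -> R} :=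
  [ffun w => x w + c * ((w == u)%:R - (w == v)%:R)].
have dS c (S : {set V}) : \sum_(w in S) d c w =
    \sum_(w in S) x w + c * ((u \in S)%:R - (v \in S)%:R).
  have i1 z : \sum_(w in S) (w == z)%:R = (z \in S)%:R :> R.
    rewrite big_mkcond (bigD1 z) //= eqxx big1 ?addr0.
      by case: (z \in S).
    by move=> w /negbTE ->; case: ifP.
  rewrite -!i1 -sumrB mulr_sumr -big_split; apply: eq_bigr => w _.
  by rewrite ffunE.
have dB c : `|c| <= e -> base_polytope f (d c).
  move=> ce; split=> [S|]; last first.
    have := dS c setT; rewrite !inE subrr mulr0 addr0.
    have E (y : {ffun V -> R}) : \sum_(w in [set: V]) y w = \sum_w y w.
      by apply: eq_bigl => w; rewrite inE.
    by rewrite !E xT.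
  rewrite dS; have [tS|nS] := boolP (tight S).
    have /eqP -> : (u \in S) == (v \in S).
      by apply: contraT => uvS; case/negP: (nsep S); apply/andP.
    by rewrite subrr mulr0 addr0; move/eqP: tS => ->.
  have := eP S nS; move: ce; rewrite ler_norml => /andP[c1 c2] h.
  by case: (u \in S); case: (v \in S); rewrite /=; move: c1 c2 h e0; lra.
have ee : `|e| <= e by rewrite ger0_norm // ltW.
have : d e = x.
  apply: (xE (d e) (d (- e))); [exact: dB | by apply: dB; rewrite normrN | ].
  by move=> w; rewrite !ffunE; ring.
move/ffunP/(_ u); rewrite ffunE eqxx (negbTE uv) subr0 mulr1.
by move=> h; exfalso; move: h e0; lra.
Qed.

Let step (P : {set V}) : tight P -> P != setT ->
  exists2 v, v \notin P & tight (v |: P).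
Proof.
move=> tP PT.
have iT : tight setT && (P \proper setT) by rewrite tightT properT.
case: (@arg_minnP _ setT (fun S => tight S && (P \proper S)) (fun S : {set V} => #|S|) iT) => M /andP[tM PM] Mmin.
have [PsM [v vM vP]] := properP PM; exists v => //.
suff -> : v |: P = M by [].
apply/eqP; rewrite eqEsubset subUset sub1set vM PsM /=.
apply/subsetP=> u uM; rewrite !inE; case: eqVneq => //= uv.
apply/negPn/negP=> uP; have [S tS uvS] := separated uv.
pose N := (S :|: P) :&: M.
have tN : tight N.
  have /andP[_ tU] := tightUI tS tP.
  by have /andP[] := tightUI tU tM.
have PN : P \proper N.
  apply/properP; split; first by rewrite subsetI subsetUr PsM.
  move: uvS; have [uS|uS] := boolP (u \in S) => h.
    by exists u; rewrite // !inE uS uM.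
  by exists v; rewrite // !inE vM andbT; case: (v \in S) h.
have NM : N \proper M.
  apply/properP; split; first exact: subsetIr.
  move: uvS; have [uS|uS] := boolP (u \in S) => h.
    by exists v; rewrite // !inE (negbTE vP) orbF; case: (v \in S) h.
  by exists u; rewrite // !inE (negbTE uS) (negbTE uP).
by have := Mmin N; rewrite tN PN => /(_ isT); rewrite leqNgt proper_card.
Qed.

Lemma vertex_greedy : exists2 s, perm_eq s (enum V) & x = greedy_point s.
Proof.
have chain i : (i <= #|V|)%N -> exists s, [/\ uniq s, size s = i &
    forall j, tight [set u in take j s]].
  elim: i => [|i IH] iV.
    exists [::]; split=> // j; rewrite (_ : [set u in take j [::]] = set0) //.
  have [s [us ss st]] := IH (ltnW iV).
  have tP : tight [set u in s] by have := st (size s); rewrite take_size.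
  have PT : [set u in s] != setT.
    apply/eqP=> E; have := cardsT V; rewrite -E cardsE (card_uniqP us) ss => h.
    by rewrite h ltnn in iV.
  have [v vP tv] := step tP PT.
  exists (rcons s v); rewrite rcons_uniq size_rcons ss us.
  move: vP; rewrite inE => vs; split=> //; first by rewrite vs.
  move=> j; have [js|js] := leqP j (size s).
    by rewrite -cats1 takel_cat.
  rewrite take_oversize ?size_rcons // (_ : [set u in rcons s v] = v |: [set u in s]) //.
  by apply/setP=> u; rewrite !inE mem_rcons inE.
have [s [us ss st]] := chain _ (leqnn _).
have sV v : v \in s.
  have [||_ ->] := @uniq_min_size _ s (enum V) us; rewrite ?mem_enum //.
    by move=> w _; rewrite mem_enum.
  by rewrite ss cardT.
exists s; last by apply: prefixes_tight_eq => // j; apply/eqP/st.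
by apply: uniq_perm (enum_uniq _) _ => // v; rewrite sV mem_enum.
Qed.
End Converse.

Lemma vertexP x :
  vertex x <-> exists2 s, perm_eq s (enum V) & x = greedy_point s.
Proof.
split=> [|[s sE ->]]; first exact: vertex_greedy.
apply: greedy_vertex => [|v]; first by rewrite (perm_uniq sE) enum_uniq.
by rewrite (perm_mem sE) mem_enum.
Qed.
End Vertices.

Section GreedyProgram.
Variables (R : rcfType) (V : finType) (f : {set V} -> R).

Lemma always_impl A (p : prog R V A) (P P' : A -> nat -> nat -> Prop) :
  (forall a t q, P a t q -> P' a t q) -> always f p P -> always f p P'.
Proof.
elim: p P P' => //= [a|o k IH|x y k IH|X k IH|k IH|k IH] P P' PP'.
- exact: PP'.
- by apply: IH => a t q; apply: PP'.
- by apply: IH => a t q; apply: PP'.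
- by apply: IH => a t q; apply: PP'.
- by move=> h s sV; apply: IH (h s sV).
- by move=> h b; apply: IH (h b).
Qed.

Lemma always_bind A B (p : prog R V A) (k : A -> prog R V B)
    (P : B -> nat -> nat -> Prop) :
  always f (bind p k) P <->
  always f p (fun a t q => always f (k a) (fun b t' q' =>
    P b (t + t')%N (q + q')%N)).
Proof.
elim: p P => [a|o c IH|x y c IH|X c IH|c IH|c IH|] P //=; try exact: IH.
- by split=> h s sV; apply/(IH s); apply: h.
- by split=> h b; apply/(IH b); apply: h.
Qed.

Lemma always_greedy_min (h : {set V} -> prog R V R) (F : {set V} -> R) s :
  (forall S, always f (h S) (fun a _ _ => a = F S)) ->
  perm_eq s (enum V) ->
  always f (greedy_min h s) (fun x _ _ => x = greedy_point F s).
Proof.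
move=> hF sE; have us : uniq s by rewrite (perm_uniq sE) enum_uniq.
have gen s2 : forall s1 (x : {ffun V -> R}), s = s1 ++ s2 ->
    (forall v, v \in s1 -> x v = greedy_point F s v) ->
    always f (greedy_from h x [set u in s1] (F [set u in s1]) s2)
      (fun x _ _ => x = greedy_point F s); last first.
  rewrite /greedy_min /=; apply/always_bind; apply: always_impl (hF set0).
  move=> _ _ _ ->; have -> : set0 = [set u in Nil V].
    by apply/setP => u; rewrite !inE.
  by apply: always_impl (gen s [::] _ _ _).
elim: s2 => [|v s2 IH] s1 x sE' xP /=.
  apply/ffunP => v; apply: xP.
  by rewrite -[s1]cats0 -sE' (perm_mem sE) mem_enum.
apply/always_bind; apply: always_impl (hF _) => _ _ _ ->.
rewrite /sub /compute /=.
have -> : v |: [set u in s1] = [set u in rcons s1 v].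
  by apply/setP=> u; rewrite !inE mem_rcons inE.
have e1 : s = rcons s1 v ++ s2 by rewrite cat_rcons.
apply: always_impl (IH _ _ e1 _) => //.
move=> u; rewrite mem_rcons inE ffunE; case: eqVneq => [-> _|_ /= /xP //].
have ix : index v s = size s1.
  rewrite sE' index_cat /= eqxx addn0 ifN //.
  by move: us; rewrite sE' cat_uniq /= negb_or => /and3P[_ /andP[]].
have t1 : take (size s1) s = s1 by rewrite sE' take_size_cat.
have t2 : take (size s1).+1 s = rcons s1 v by rewrite e1 take_size_cat ?size_rcons.
by rewrite ffunE ix t1 t2.
Qed.
Definition shift (mu : R) (S : {set V}) : R :=
  if (S == set0) || (S == [set: V]) then 0 else f S + mu.

Lemma always_shifted mu S :
  always f (shifted mu S) (fun a _ _ => a = shift mu S).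
Proof. by rewrite /shifted /shift; case: ifP. Qed.

Lemma always_pick_vertex mu :
  always f (pick_vertex (shifted mu)) (fun g _ _ =>
    exists2 s, perm_eq s (enum V) & g = greedy_point (shift mu) s).
Proof.
move=> s sE; apply: always_impl (always_greedy_min (always_shifted mu) sE).
by move=> g _ _ ->; exists s.
Qed.
End GreedyProgram.

(* Main.v *)
Require Import Defs.
From mathcomp Require Import all_boot all_order all_algebra.
From mathcomp Require Import reals exp.
From mathcomp Require Import zify ring lra.

(** Optimality of the result comes from a volume argument.

    Throughout the algorithm mu = - f(W) and mu >= max(0, - f(V)), so every
    shifted function f_mu is submodular, f_mu grows with mu away from the empty
    set and V, and each greedy point g computed so far satisfies
    g(S) <= f_mu(S) for all S and the current mu ([generator_le]).

    Suppose that some S has f(S) < f(W).  By integrality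
    f_mu(S) = f(S) - f(W) <= -1, hence g(S) <= -1 for every such g: the indicator
    of S lies in the polar cone of the greedy points, together with a
    cross-polytope around it whose radius is the inverse of a bound on the entries
    of the g.  In
    particular no convex combination of the normalized g can vanish
    ([improving_weighted_sum_neq0]), so the test y = 0 only succeeds when W is
    optimal.

    One call of Sliding von Neumann keeps y.Qg <= 0 for the newest point g: if
    the greedy point violates this, Abel summation ([greedy_dot_le0]) produces a
    prefix with negative value, and sliding mu to make the least such value zero
    turns g into a greedy point that satisfies it ([runs_slide]).  The orthogonal
    projection onto the segment from y to g/||g||_Q then increases ||y||_Q^-2 by
    at least 1 ([von_neumann_step]), which bounds the number of steps by
    1/eps^2 = 400 n^2.

    When the call ends with 0 < ||y||_Q <= eps, the rescaling of R = Q^-1 does two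
    things.  On the polar cone the norm ||p||_R does not increase
    ([updated_cone]), so that it stays below the Euclidean norm.  The determinant
    of R grows by a factor 9/5 as long as W is not optimal ([updated_det]): the
    update has trace 1 relative to R, so it at least doubles the determinant, and
    the division by (1 + eps)^(2n) costs at most a factor 10/9.

    Since the polar cone contains a cross-polytope around the indicator of S, the first
    property bounds the diagonal entries of R by (n L)^3 ([diagonal_bound]), and
    Hadamard's inequality ([det_le_diag]) gives det R <= (n L)^(3n).  This is less
    than (9/5)^T after T = 5 n log(n L) rounds ([rounds_suffice]), a
    contradiction, so W is optimal.

    The running time is obtained together with correctness: [runs] bounds
    arithmetic operations and queries, and each routine of the algorithm gets one
    lemma stating its result and its cost. *)

Set Implicit Arguments.
Unset Strict Implicit.
Unset Printing Implicit Defensive.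

Import Order.TTheory GRing.Theory Num.Theory.
Local Open Scope ring_scope.

(** * Cost-bounded specifications of programs *)
Section Cost.
Variables (R : rcfType) (V : finType) (f : {set V} -> R).
Local Notation prog := (prog R V).

(** A postcondition on the result together with upper bounds on both costs: this
    weakening of [always] composes along [bind] by adding the bounds. *)
Definition runs A (p : prog A) (t0 q0 : nat) (P : A -> Prop) : Prop :=
  always f p (fun a t q => [/\ P a, (t <= t0)%N & (q <= q0)%N]).

Lemma runs_weaken A (p : prog A) t q t' q' (P P' : A -> Prop) :
  runs p t q P -> (t <= t')%N -> (q <= q')%N -> (forall a, P a -> P' a) ->
  runs p t' q' P'.
Proof.
move=> h tt qq PP; apply: always_impl h => a t1 q1 [Pa t1t q1q].
by split; [exact: PP | exact: leq_trans tt | exact: leq_trans qq].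
Qed.

Lemma runs_ret A (a : A) t q (P : A -> Prop) : P a -> runs (Ret a) t q P.
Proof. by []. Qed.

Lemma runs_bind A B (p : prog A) (k : A -> prog B) t1 q1 t2 q2 P (P' : B -> Prop) :
  runs p t1 q1 P -> (forall a, P a -> runs (k a) t2 q2 P') ->
  runs (bind p k) (t1 + t2) (q1 + q2) P'.
Proof.
move=> hp hk; apply/always_bind; apply: always_impl hp => a t q [Pa tt qq].
apply: always_impl (hk _ Pa) => b t' q' [Pb t't q'q].
by split=> //; exact: leq_add.
Qed.

(** The form of the sequencing rule used below: the remaining budget is given
    explicitly and only inequalities between budgets remain to be checked. *)
Lemma runs_bind_le A B (p : prog A) (k : A -> prog B) t1 q1 t2 q2 t q P (P' : B -> Prop) :
  runs p t1 q1 P -> (t1 + t2 <= t)%N -> (q1 + q2 <= q)%N ->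
  (forall a, P a -> runs (k a) t2 q2 P') -> runs (bind p k) t q P'.
Proof. by move=> hp tt qq hk; apply: runs_weaken (runs_bind hp hk) tt qq _. Qed.

Lemma runs_compute o : runs (compute V o) 1 0 (fun a => a = eval o).
Proof. by []. Qed.

Lemma runs_bind_compute A o (k : R -> prog A) t q P :
  runs (k (eval o)) t q P -> runs (bind (compute V o) k) t.+1 q P.
Proof. by move=> h; apply: (always_impl _ h) => a t' q' []. Qed.

Lemma runs_bind_leq A x y (k : bool -> prog A) t q P :
  runs (k (x <= y)) t q P -> runs (bind (Defs.leq V x y) k) t.+1 q P.
Proof. by move=> h; apply: (always_impl _ h) => a t' q' []. Qed.

Lemma runs_bind_query A S (k : R -> prog A) t q P :
  runs (k (f S)) t q P -> runs (bind (query R S) k) t q.+1 P.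
Proof. by move=> h; apply: (always_impl _ h) => a t' q' []. Qed.

(** The invariant speaks of the prefix of the list already processed, and its
    preservation may use the decomposition of the whole list, which is how
    distinctness of the indices is exploited in [runs_inverse]. *)
Lemma runs_foldM I B (F : B -> I -> prog B) (Inv : seq I -> B -> Prop) t q
    (s : seq I) (b : B) :
  (forall s1 i s2 b, s = s1 ++ i :: s2 -> Inv s1 b ->
     runs (F b i) t q (fun b' => Inv (rcons s1 i) b')) ->
  Inv [::] b ->
  runs (foldM F b s) (size s * t) (size s * q) (fun b' => Inv s b').
Proof.
move=> hF.
have gen s2 : forall s1 b, s = s1 ++ s2 -> Inv s1 b ->
    runs (foldM F b s2) (size s2 * t) (size s2 * q) (fun b' => Inv s b').
  elim: s2 => [|i s2 IH] s1 b' e Ib; first by apply: runs_ret; rewrite e cats0.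
  rewrite /= !mulSn; apply: runs_bind (hF s1 i s2 b' e Ib) _ => b2 Ib2.
  by apply: IH Ib2; rewrite e cat_rcons.
by move=> I0; apply: (gen s [::]).
Qed.

Lemma runs_tabulate (I : finType) (F : I -> prog R) (G : I -> R) t q :
  (forall i, runs (F i) t q (fun a => a = G i)) ->
  runs (tabulate F) (#|I| * t).+1 (#|I| * q) (fun x => x = [ffun i => G i]).
Proof.
move=> hF; apply: runs_bind_compute; rewrite cardE.
apply: (runs_weaken (P := fun x : {ffun I -> R} =>
          forall i, i \in enum I -> x i = G i)) (leqnn _) (leqnn _) _.
  apply: (runs_foldM (Inv := fun s (x : {ffun I -> R}) =>
            forall i, i \in s -> x i = G i)) => //.
  move=> s1 i s2 b _ Ib; rewrite -[t]addn0 -[q]addn0.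
  apply: runs_bind (hF i) _ => a ->; apply: runs_ret => j.
  by rewrite mem_rcons inE ffunE; case: eqVneq => [->|_ /= /Ib].
by move=> x xG; apply/ffunP=> i; rewrite ffunE xG // mem_enum.
Qed.
End Cost.

(** The cardinal of V occurs in the types of vectors and matrices; abstracting it
    and the list sizes leaves a polynomial inequality over natural numbers. *)
Ltac solve_cost :=
  match goal with V0 : is_true (0 < #|_|)%N |- _ => move: V0 end;
  repeat (move: (size _) => ?); move: #|_| => ? ?; first [lia | nia].

(** * Positive definite forms and determinants *)
Section Forms.
Variables (R : realFieldType) (n : nat).
Implicit Types (A Q : 'M[R]_n) (x y z : 'cV[R]_n).

Definition bilin A x y : R := (x^T *m A *m y) 0 0.

Lemma bilinDl A x y z : bilin A (x + y) z = bilin A x z + bilin A y z.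
Proof. by rewrite /bilin linearD /= !mulmxDl mxE. Qed.
Lemma bilinDr A x y z : bilin A z (x + y) = bilin A z x + bilin A z y.
Proof. by rewrite /bilin mulmxDr mxE. Qed.
Lemma bilinZl A a x z : bilin A (a *: x) z = a * bilin A x z.
Proof. by rewrite /bilin linearZ /= -!scalemxAl mxE. Qed.
Lemma bilinZr A a x z : bilin A z (a *: x) = a * bilin A z x.
Proof. by rewrite /bilin -scalemxAr mxE. Qed.
Lemma bilinNl A x z : bilin A (- x) z = - bilin A x z.
Proof. by rewrite -scaleN1r bilinZl mulN1r. Qed.
Lemma bilinNr A x z : bilin A z (- x) = - bilin A z x.
Proof. by rewrite -scaleN1r bilinZr mulN1r. Qed.
Lemma bilin0l A z : bilin A 0 z = 0.
Proof. by rewrite -[0](scale0r 0) bilinZl mul0r. Qed.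
Lemma bilin0r A z : bilin A z 0 = 0.
Proof. by rewrite -[0](scale0r 0) bilinZr mul0r. Qed.
Lemma bilin_sumr A I (s : seq I) (F : I -> 'cV[R]_n) z :
  bilin A z (\sum_(i <- s) F i) = \sum_(i <- s) bilin A z (F i).
Proof.
elim: s => [|i s IH]; first by rewrite !big_nil bilin0r.
by rewrite !big_cons bilinDr IH.
Qed.
Lemma bilinDm A B x y : bilin (A + B) x y = bilin A x y + bilin B x y.
Proof. by rewrite /bilin mulmxDr mulmxDl mxE. Qed.
Lemma bilinZm a A x y : bilin (a *: A) x y = a * bilin A x y.
Proof. by rewrite /bilin -scalemxAr -scalemxAl mxE. Qed.
Lemma bilin_summ I (s : seq I) (F : I -> 'M[R]_n) x y :
  bilin (\sum_(i <- s) F i) x y = \sum_(i <- s) bilin (F i) x y.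
Proof.
elim: s => [|i s IH]; first by rewrite !big_nil /bilin mulmx0 mul0mx mxE.
by rewrite !big_cons bilinDm IH.
Qed.
Lemma bilin_mulr A Q x y : bilin A x (Q *m y) = bilin (A *m Q) x y.
Proof. by rewrite /bilin !mulmxA. Qed.
Lemma bilin_rank1 g x y : bilin (g *m g^T) x y = bilin 1%:M g x * bilin 1%:M g y.
Proof.
rewrite /bilin !mulmx1 mulmxA -mulmxA.
rewrite [x^T *m g]mx11_scalar [g^T *m y]mx11_scalar -scalar_mxM !mxE eqxx mulr1n.
by congr (_ * _); apply: eq_bigr => i _; rewrite !mxE mulrC.
Qed.

Lemma bilinC A x y : A^T = A -> bilin A x y = bilin A y x.
Proof.
move=> At; rewrite /bilin -[LHS]trace_mx11 -mxtrace_tr !trmx_mul trmxK At mulmxA.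
by rewrite trace_mx11.
Qed.

Definition posdef A := A^T = A /\ forall x, x != 0 -> 0 < bilin A x x.

Lemma posdef_ge0 A x : posdef A -> 0 <= bilin A x x.
Proof.
by move=> [_ Ap]; have [->|/Ap/ltW//] := eqVneq x 0; rewrite bilin0l.
Qed.

(** Cauchy-Schwarz, from the nonnegativity of the form at
    (x.x) y - (x.y) x. *)
Lemma bilin_cauchy A x y : posdef A -> bilin A x y ^+ 2 <= bilin A x x * bilin A y y.
Proof.
move=> Ap; have [->|x0] := eqVneq x 0; first by rewrite !bilin0l expr0n mul0r.
have xp := Ap.2 _ x0.
have := posdef_ge0 (bilin A x x *: y - bilin A x y *: x) Ap.
rewrite bilinDl !bilinDr !bilinNl !bilinNr !bilinZl !bilinZr (bilinC y x Ap.1).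
have -> : bilin A x x * (bilin A x x * bilin A y y) - bilin A x x * (bilin A x y * bilin A x y) +
 (- (bilin A x y * (bilin A x x * bilin A x y)) - - (bilin A x y * (bilin A x y * bilin A x x))) =
 bilin A x x * (bilin A x x * bilin A y y - bilin A x y ^+ 2) by ring.
by rewrite pmulr_rge0 // subr_ge0.
Qed.

Lemma bilin1E x y : bilin 1%:M x y = \sum_i x i 0 * y i 0.
Proof. by rewrite /bilin mulmx1 mxE; apply: eq_bigr => i _; rewrite mxE. Qed.

Lemma posdef1 : posdef 1%:M.
Proof.
split=> [|x x0]; first by rewrite trmx1.
rewrite bilin1E; have [i xi] : exists i, x i 0 != 0.
  apply/existsP; apply: contraR x0; rewrite negb_exists => /forallP h.
  by apply/eqP/matrixP=> i j; rewrite ord1 mxE; apply/eqP; move: (h i); rewrite negbK.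
rewrite (bigD1 i) //= ltr_pwDl ?sumr_ge0 //.
  by rewrite -expr2 exprn_even_gt0.
by move=> j _; rewrite -expr2 sqr_ge0.
Qed.

Lemma posdef_scale a A : 0 < a -> posdef A -> posdef (a *: A).
Proof.
move=> a0 [At Ap]; split=> [|x /Ap x0]; first by rewrite linearZ /= At.
by rewrite bilinZm mulr_gt0.
Qed.

Lemma posdef_rank1 c A (g : 'cV[R]_n) : 0 <= c -> posdef A -> posdef (A + c *: (g *m g^T)).
Proof.
move=> c0 [At Ap]; split=> [|x /Ap x0].
  by rewrite linearD /= linearZ /= trmx_mul trmxK At.
by rewrite bilinDm bilinZm bilin_rank1 ltr_wpDr // mulr_ge0 // -expr2 sqr_ge0.
Qed.

Lemma posdef_unit A : posdef A -> A \in unitmx.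
Proof.
move=> [At Ap]; rewrite -unitmx_tr -row_free_unit -kermx_eq0.
apply: contraT => /rowV0Pn[u /sub_kermxP uA u0].
have : u^T != 0 by apply: contra u0 => /eqP h; rewrite -[u]trmxK h trmx0.
move/Ap; rewrite /bilin trmxK.
by have -> : u *m A *m u^T = 0; [rewrite -At uA mul0mx | rewrite mxE ltxx].
Qed.

Lemma bilin_invmx A x y : posdef A -> bilin A (invmx A *m x) (invmx A *m y) = bilin (invmx A) x y.
Proof.
move=> Ap; have Au := posdef_unit Ap.
by rewrite /bilin !trmx_mul trmx_inv Ap.1 mulmxKV // mulmxA.
Qed.

Lemma posdef_inv A : posdef A -> posdef (invmx A).
Proof.
move=> Ap; have Au := posdef_unit Ap; split=> [|x x0].
  by rewrite trmx_inv Ap.1.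
rewrite -bilin_invmx //; apply: Ap.2; apply: contra x0 => /eqP h.
by rewrite -[x](mulKVmx Au) h mulmx0.
Qed.

(** The norms defined by A and by its inverse are dual to each other. *)
Lemma bilin_cauchy_dual A p y : posdef A ->
  bilin 1%:M p y ^+ 2 <= bilin A p p * bilin (invmx A) y y.
Proof.
move=> Ap; have Au := posdef_unit Ap.
have -> : bilin 1%:M p y = bilin A p (invmx A *m y).
  by rewrite bilin_mulr mulmxV.
by rewrite -[bilin (invmx A) _ _]bilin_invmx //; apply: bilin_cauchy.
Qed.
End Forms.

Section Det.
Variable R : realFieldType.

(** Matrix determinant lemma: with u = c A^-1 g, the block matrix
    (1, -g^T; u, 1) has determinant det(1 + u g^T) by elimination of its first
    column and 1 + g^T u by elimination of its last one. *)
Lemma det_rank1 n (A : 'M[R]_n) (g : 'cV[R]_n) c : A \in unitmx ->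
  \det (A + c *: (g *m g^T)) = \det A * (1 + c * bilin (invmx A) g g).
Proof.
move=> Au; pose u := c *: (invmx A *m g).
have -> : A + c *: (g *m g^T) = A *m (1%:M + u *m g^T).
  by rewrite mulmxDr mulmx1 mulmxA /u -scalemxAr mulKVmx // -scalemxAl.
rewrite det_mulmx; congr (_ * _).
have e1 : block_mx 1%:M (- g^T) u 1%:M =
  block_mx 1%:M 0 u 1%:M *m block_mx 1%:M (- g^T) 0 (1%:M + u *m g^T).
  rewrite mulmx_block ?(mul1mx, mul0mx, mulmx0, mulmx1, addr0, mulmxN).
  by rewrite [_ + (_ + _)]addrCA addNr addr0.
have e2 : block_mx 1%:M (- g^T) u 1%:M =
  block_mx 1%:M (- g^T) 0 1%:M *m block_mx (1%:M + g^T *m u) 0 u 1%:M.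
  rewrite mulmx_block ?(mul1mx, mul0mx, mulmx0, mulmx1, add0r, mulNmx).
  by rewrite addrK.
have := congr1 determinant e2; rewrite e1 !det_mulmx !det_lblock !det_ublock !det1 !mul1r.
rewrite !mulr1 => ->; rewrite det_mx11 mxE; congr (_ + _).
  by rewrite mxE eqxx.
by rewrite /u -scalemxAr mulmxA mxE.
Qed.

Lemma invmx_unique n (A B : 'M[R]_n) : A *m B = 1%:M -> invmx A = B.
Proof.
by move=> AB; have [Au _] := mulmx1_unit AB; rewrite -[B](mulKmx Au) AB mulmx1.
Qed.

(** Sherman-Morrison formula. *)
Lemma invmx_rank1 n (A : 'M[R]_n) (g : 'cV[R]_n) c : posdef A -> 0 <= c ->
  let q := invmx A *m g in
  invmx (A + c *: (g *m g^T)) =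
    invmx A - (c / (1 + c * bilin (invmx A) g g)) *: (q *m q^T).
Proof.
move=> Ap c0; move E: (invmx A *m g) => q /=; have Au := posdef_unit Ap; apply: invmx_unique.
have a0 := posdef_ge0 g (posdef_inv Ap); set a := bilin _ g g in a0 *.
have qT : q^T = g^T *m invmx A by rewrite -E trmx_mul (posdef_inv Ap).1.
have e : g *m g^T *m (q *m q^T) = a *: (g *m q^T).
  rewrite !mulmxA -[g *m _ *m q]mulmxA [g^T *m q]mx11_scalar.
  by rewrite -E mulmxA mul_mx_scalar -scalemxAl E.
rewrite mulmxBr !mulmxDl mulmxV // -!scalemxAr -!scalemxAl e.
rewrite -[g *m g^T *m invmx A]mulmxA -qT mulmxA -E mulmxA mulmxV // mul1mx E.
rewrite !scalerA -!scalerDl -addrA -scalerBl -[RHS]addr0; congr (_ + _).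
apply/eqP; rewrite scaler_eq0; apply/orP; left; apply/eqP.
have : 1 + c * a != 0 by rewrite gt_eqF // ltr_wpDr // mulr_ge0.
by move=> h; field.
Qed.

Lemma posdef_update (I : eqType) (s : seq I) (c : I -> R) n (g : I -> 'cV[R]_n) (A : 'M[R]_n) :
  posdef A -> (forall i, i \in s -> 0 <= c i) ->
  posdef (A + \sum_(i <- s) c i *: (g i *m (g i)^T)).
Proof.
elim: s A => [|i s IH] A Ap c0; first by rewrite big_nil addr0.
rewrite big_cons addrA; apply: IH => [|j js]; last by rewrite c0 // inE js orbT.
by apply: posdef_rank1; rewrite // c0 // mem_head.
Qed.

(** The inequality det(1 + M) >= 1 + tr M for positive semidefinite M, relative
    to A and without diagonalization.  The terms are added one at a time; after
    adding c g g^T, the determinant times the inverse form can only have grown,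
    because Sherman-Morrison and Cauchy-Schwarz give
    (1 + c g.Qg) (x.Q'x) = x.Qx + c ((g.Qg)(x.Qx) - (g.Qx)^2) >= x.Qx
    where Q and Q' are the inverses before and after the addition. *)
Lemma det_update_ge (I : eqType) (s : seq I) (c : I -> R) n (g : I -> 'cV[R]_n) (A : 'M[R]_n) :
  posdef A -> 0 <= \det A -> (forall i, i \in s -> 0 <= c i) ->
  \det A * (1 + \sum_(i <- s) c i * bilin (invmx A) (g i) (g i)) <=
  \det (A + \sum_(i <- s) c i *: (g i *m (g i)^T)).
Proof.
move=> Ap dA; elim: s A Ap dA => [|i s IH] A Ap dA c0'.
  by rewrite !big_nil !addr0 mulr1.
rewrite !big_cons [in leRHS]addrA.
have c0 : 0 <= c i by rewrite c0' ?mem_head.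
have cs j : j \in s -> 0 <= c j by move=> js; rewrite c0' // inE js orbT.
have Bp := posdef_rank1 (g i) c0 Ap.
have Qp := posdef_inv Ap.
have q0 : 0 <= c i * bilin (invmx A) (g i) (g i) by rewrite mulr_ge0 ?posdef_ge0.
have dB := det_rank1 (g i) (c i) (posdef_unit Ap).
have dB0 : 0 <= \det (A + c i *: (g i *m (g i)^T)).
  by rewrite dB mulr_ge0 // addr_ge0.
apply: le_trans (IH _ Bp dB0 cs); rewrite dB -mulrA ler_wpM2l //.
set q := c i * _; rewrite mulrDr mulr1 addrA lerD2l mulr_sumr.
rewrite !big_seq; apply: ler_sum => j /cs cj; rewrite mulrCA ler_wpM2l //.
rewrite invmx_rank1 // -/q bilinDm -scaleNr bilinZm bilin_rank1.
have -> : bilin 1%:M (invmx A *m g i) (g j) = bilin (invmx A) (g i) (g j).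
  by rewrite /bilin mulmx1 trmx_mul Qp.1.
have := bilin_cauchy (g i) (g j) Qp; set b := bilin _ (g i) (g j).
set x := bilin _ (g j) (g j) => bcs.
have h : 0 < 1 + q by rewrite ltr_wpDr.
have -> : (1 + q) * (x + - (c i / (1 + q)) * (b * b)) = x + (q * x - c i * b ^+ 2).
  by field; rewrite gt_eqF.
by rewrite lerDl subr_ge0 /q -mulrA ler_wpM2l.
Qed.

(** Hadamard's inequality, by induction on the dimension: the Schur complement of
    the first entry is again positive definite, and its diagonal entries are at
    most those of the original matrix. *)
Lemma det_le_diag n (A : 'M[R]_n) : posdef A -> \det A <= \prod_i A i i.
Proof.
elim: n A => [|n IH] A Ap; first by rewrite det_mx00 big_ord0.
have diag_gt0 m (B : 'M[R]_m) i : posdef B -> 0 < B i i.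
  move=> [_ Bp]; have : delta_mx i 0 != 0 :> 'cV[R]_m.
    by apply/eqP => /matrixP/(_ i 0); rewrite !mxE !eqxx => /eqP; rewrite oner_eq0.
  by move/Bp; rewrite /bilin trmx_delta -rowE -colE !mxE.
move: A Ap; rewrite -[n.+1]/(1 + n)%N => A Ap.
pose b := ursubmx A; pose D := drsubmx A; pose a := A 0 0.
have a0 : 0 < a by apply: diag_gt0.
have Aul : ulsubmx A = a%:M.
  by rewrite [ulsubmx A]mx11_scalar !mxE; congr (_%:M); congr (A _ _); apply: val_inj.
have Adl : dlsubmx A = b^T by rewrite /b trmx_ursub Ap.1.
have AE : A = block_mx a%:M b b^T D by rewrite -Aul -Adl submxK.
(* Schur complement of the entry a. *)
pose S := D - a^-1 *: (b^T *m b).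
have AS : A = block_mx 1%:M 0 (a^-1 *: b^T) 1%:M *m block_mx a%:M b 0 S.
  rewrite mulmx_block ?(mul1mx, mul0mx, mulmx0, mulmx1, addr0) AE.
  by rewrite mul_mx_scalar scalerA divff ?gt_eqF // scale1r -scalemxAl addrC subrK.
have -> : \det A = a * \det S.
  by rewrite AS det_mulmx det_lblock det_ublock !det1 !mul1r det_scalar1.
have Sp : posdef S.
  split.
    by rewrite /S linearB linearZ /= trmx_mul trmxK /D trmx_drsub Ap.1.
  (* z minimizes the form of A among the vectors that extend x. *)
  move=> x x0; pose z : 'cV[R]_(1 + n) := col_mx (- a^-1 *: (b *m x)) x.
  have z0 : z != 0.
    by apply: contra x0 => /eqP h; rewrite -[x](col_mxKd (- a^-1 *: (b *m x))) -/z h linear0.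
  have := Ap.2 _ z0; suff -> : bilin A z z = bilin S x x by [].
  rewrite /bilin AS mulmxA -mulmxA mul_block_col !mul0mx add0r.
  rewrite mul_scalar_mx scalerA mulrN divff ?gt_eqF // scaleN1r addNr.
  have -> : z^T *m block_mx 1%:M 0 (a^-1 *: b^T) 1%:M = row_mx 0 x^T.
    rewrite tr_col_mx mul_row_block ?(mul1mx, mul0mx, mulmx0, mulmx1, addr0, add0r).
    by rewrite linearZ /= trmx_mul -scalemxAr scaleNr addNr.
  by rewrite mul_row_col mul0mx add0r mulmxA.
rewrite big_split_ord /= big_ord1.
have -> : A (lshift n 0) (lshift n 0) = a by congr (A _ _); apply: val_inj.
rewrite ler_pM2l //; apply: le_trans (IH _ Sp) _.
apply: ler_prod => i _; rewrite ltW ?diag_gt0 //=.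
rewrite /S /D !mxE lerBlDr lerDl mulr_ge0 ?invr_ge0 ?(ltW a0) //.
by apply: sumr_ge0 => j _; rewrite !mxE -expr2 sqr_ge0.
Qed.
End Det.

(** * Linear algebra programs *)
Section Coordinates.
Variables (R : rcfType) (V : finType).
Local Notation n := #|V|.

(** Programs index vectors and matrices by V; determinants need ordinals, and
    [enum_val] transports one to the other. *)
Definition colv (x : {ffun V -> R}) : 'cV[R]_n := \col_i x (enum_val i).
Definition mxV (M : {ffun V * V -> R}) : 'M[R]_n :=
  \matrix_(i, j) M (enum_val i, enum_val j).

Lemma sum_enum_val (F : V -> R) : \sum_v F v = \sum_(i < n) F (enum_val i).
Proof.
by rewrite (reindex (@enum_val V predT)) //=; apply: onW_bij; exact: enum_val_bij.
Qed.

Lemma colv_inj : injective colv.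
Proof.
move=> x y /matrixP e; apply/ffunP => v.
by have := e (enum_rank v) 0; rewrite !mxE enum_rankK.
Qed.

Lemma bilin_colv M x y :
  bilin (mxV M) (colv x) (colv y) = \sum_u x u * \sum_v M (u, v) * y v.
Proof.
rewrite /bilin -mulmxA mxE sum_enum_val; apply: eq_bigr => i _; rewrite !mxE.
congr (_ * _); rewrite sum_enum_val; apply: eq_bigr => j _.
by rewrite !mxE.
Qed.

Lemma bilin1_colv x y : bilin 1%:M (colv x) (colv y) = \sum_v x v * y v.
Proof. by rewrite bilin1E sum_enum_val; apply: eq_bigr => i _; rewrite !mxE. Qed.

Lemma colv_lin a b (x y : {ffun V -> R}) :
  colv [ffun v => a * x v + b * y v] = a *: colv x + b *: colv y.
Proof. by apply/matrixP=> i j; rewrite !mxE ffunE. Qed.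
End Coordinates.

Section GaussJordan.
Variables (R : rcfType) (V : finType).
Implicit Types (M N : {ffun V * V -> R}) (x y : V -> R).

(** Matrices are identified with the linear relation y = M x, on which an
    exchange step is just a renaming of variables. *)
Definition represents M x y := forall u, y u = \sum_v M (u, v) * x v.

Definition exchange (s : seq V) x y v := if v \in s then y v else x v.

(** The value computed by [pivot]. *)
Definition pivoted M k : {ffun V * V -> R} := [ffun uv =>
  if (uv.1 == k) && (uv.2 == k) then 1 / M (k, k)
  else if uv.1 == k then 0 - M (k, uv.2) / M (k, k)
  else if uv.2 == k then M (uv.1, k) / M (k, k)
  else M uv - M (uv.1, k) * M (k, uv.2) / M (k, k)].

Lemma represents_ext M x y x' y' : x =1 x' -> y =1 y' -> represents M x y -> represents M x' y'.
Proof. by move=> ex ey h u; rewrite -ey h; apply: eq_bigr => v _; rewrite ex. Qed.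

(** Both sides say y_u = M_uk x_k + S_u for all u, where S_u collects the other
    terms; on the right, the k-th equation has been solved for x_k and
    substituted into the others. *)
Lemma represents_pivoted M k x y : M (k, k) != 0 ->
  represents M x y <-> represents (pivoted M k) (exchange [:: k] x y) (exchange [:: k] y x).
Proof.
move=> p0; pose S u := \sum_(v | v != k) M (u, v) * x v.
have e1 u : \sum_v M (u, v) * x v = M (u, k) * x k + S u by rewrite (bigD1 k).
have ek : exchange [:: k] x y k = y k by rewrite /exchange inE eqxx.
have ek' : exchange [:: k] y x k = x k by rewrite /exchange inE eqxx.
have ev v : v != k -> exchange [:: k] y x v = y v.
  by move=> vk; rewrite /exchange inE (negbTE vk).
have e2 : \sum_v pivoted M k (k, v) * exchange [:: k] x y v =
    y k / M (k, k) - S k / M (k, k).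
  rewrite (bigD1 k) //= ek !ffunE /= eqxx /= /S mulr_suml -sumrN.
  congr (_ + _); first by field.
  apply: eq_bigr => v vk; rewrite ffunE /= eqxx (negbTE vk) /= sub0r.
  by rewrite /exchange inE (negbTE vk); field.
have e3 u : u != k -> \sum_v pivoted M k (u, v) * exchange [:: k] x y v =
    M (u, k) / M (k, k) * y k + (S u - M (u, k) / M (k, k) * S k).
  move=> uk; rewrite (bigD1 k) //= ek !ffunE /= eqxx (negbTE uk) /=.
  congr (_ + _); rewrite /S mulr_sumr -sumrB.
  apply: eq_bigr => v vk; rewrite ffunE /= (negbTE uk) (negbTE vk) /=.
  by rewrite /exchange inE (negbTE vk); field.
split=> h u.
  have hk := h k; rewrite e1 in hk.
  have [->|uk] := eqVneq u k; first by rewrite ek' e2 hk; field.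
  by rewrite ev // e3 // (h u) e1 hk; field.
have hk := h k; rewrite ek' e2 in hk.
rewrite e1 hk; have [->|uk] := eqVneq u k; first by field.
by have := h u; rewrite ev // e3 // => ->; field.
Qed.

(** Feeding the k-th unit vector into the exchanged relation gives a vector x
    with x_k = 1 for which x and M x have complementary supports except at k;
    hence x.Mx is exactly the pivot, and it is positive by definiteness. *)
Lemma pivot_gt0 M N s k : posdef (mxV M) -> k \notin s ->
  (forall x y, represents M x y <-> represents N (exchange s x y) (exchange s y x)) ->
  0 < N (k, k).
Proof.
move=> [_ Mp] ks MN.
pose a v : R := (v == k)%:R; pose b u := N (u, k).
have ab : represents N a b.
  move=> u; rewrite (bigD1 k) //= /a eqxx mulr1 big1 ?addr0 // => v /negbTE ->.
  by rewrite mulr0.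
pose x : {ffun V -> R} := [ffun v => exchange s a b v].
have xy : represents M x (exchange s b a).
  apply/MN; apply: represents_ext ab => v; rewrite /exchange ?ffunE /exchange;
  by case: (v \in s).
have x0 : colv x != 0.
  apply/eqP => h; have : x = [ffun=> 0].
    by apply: colv_inj; rewrite h; apply/matrixP=> i j; rewrite !mxE ffunE.
  move/ffunP/(_ k); rewrite !ffunE /exchange (negbTE ks) /a eqxx.
  by move/eqP; rewrite oner_eq0.
have := Mp _ x0; rewrite bilin_colv.
have -> : \sum_u x u * (\sum_v M (u, v) * x v) = \sum_u a u * b u.
  apply: eq_bigr => u _; rewrite -xy ffunE /exchange.
  by case: (u \in s); rewrite // mulrC.
rewrite (bigD1 k) //= /a eqxx mul1r big1 ?addr0 // => v /negbTE ->.
by rewrite mul0r.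
Qed.

Lemma represents_invmx M N : (forall x y, represents M x y <-> represents N y x) ->
  mxV N = invmx (mxV M).
Proof.
move=> MN; apply/esym/invmx_unique/matrixP => i j; rewrite !mxE.
pose y v : R := (v == enum_val j)%:R.
have Ny : represents N y (fun v => N (v, enum_val j)).
  move=> u; rewrite (bigD1 (enum_val j)) //= /y eqxx mulr1 big1 ?addr0 //.
  by move=> v /negbTE ->; rewrite mulr0.
have /MN/(_ (enum_val i)) := Ny; rewrite /y (inj_eq enum_val_inj) => ->.
by rewrite [RHS]sum_enum_val; apply: eq_bigr => k _; rewrite !mxE.
Qed.
End GaussJordan.

Section LinearPrograms.
Variables (R : rcfType) (V : finType) (f : {set V} -> R).
Local Notation n := #|V|.

Lemma runs_dot x y :
  runs f (dot x y) (2 * n).+1 0 (fun a => a = bilin 1%:M (colv x) (colv y)).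
Proof.
rewrite bilin1_colv; apply: runs_bind_compute.
apply: (runs_weaken (t := size (enum V) * 2) (q := size (enum V) * 0)
  (P := fun a => a = \sum_(v <- enum V) x v * y v)); last 1 first.
- by move=> a ->; rewrite big_enum.
- apply: (runs_foldM (Inv := fun s a => a = \sum_(v <- s) x v * y v)).
    move=> s1 v s2 a _ ->; apply: runs_bind_compute; rewrite /add /compute /=.
    by rewrite -cats1 big_cat big_seq1.
  by rewrite /= big_nil.
- by rewrite -cardE mulnC.
- by rewrite muln0.
Qed.

Lemma runs_mulmv M x :
  runs f (mulmv M x) (n * (2 * n).+1).+1 0 (fun z => colv z = mxV M *m colv x).
Proof.
apply: (runs_weaken (runs_tabulate (fun u => runs_dot [ffun v => M (u, v)] x)));
  rewrite ?muln0 // => _ ->.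
apply/matrixP => i j; rewrite !mxE ffunE bilin1_colv sum_enum_val.
by apply: eq_bigr => k _; rewrite !mxE ffunE.
Qed.

Lemma runs_inner Q x y :
  runs f (inner Q x y) (2 * n * n + 3 * n + 2) 0
    (fun a => a = bilin (mxV Q) (colv x) (colv y)).
Proof.
apply: (runs_bind_le (t2 := (2 * n).+1) (q2 := 0) (runs_mulmv Q y)) => [|//|z hz].
  by nia.
by apply: runs_weaken (runs_dot x z) _ _ _ => // a ->; rewrite hz /bilin mulmx1 mulmxA.
Qed.

Lemma runs_normQ Q x :
  runs f (normQ Q x) (2 * n * n + 3 * n + 3) 0
    (fun a => a = Num.sqrt (bilin (mxV Q) (colv x) (colv x))).
Proof.
apply: (runs_bind_le (t2 := 1) (q2 := 0) (runs_inner Q x x)) => [|//|a ->].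
  by lia.
by split.
Qed.

Lemma runs_normalize Q g :
  runs f (normalize Q g) (2 * n * n + 4 * n + 4) 0
    (fun u => colv u = (Num.sqrt (bilin (mxV Q) (colv g) (colv g)))^-1 *: colv g).
Proof.
apply: (runs_bind_le (t2 := (n * 1).+1) (q2 := 0) (runs_normQ Q g)) => [|//|a ->].
  by lia.
apply: runs_weaken (runs_tabulate (fun i => runs_compute f _)) _ _ _ => //.
  by rewrite muln0.
by move=> _ ->; apply/matrixP => i j; rewrite !mxE ffunE /= mulrC.
Qed.

Lemma runs_pivot M k :
  runs f (pivot M k) (n * n * 3).+1 0 (fun N => N = pivoted M k).
Proof.
apply: runs_weaken (runs_tabulate (t := 3) (q := 0) _) _ _ _; first last.
- by move=> N ->.
- by rewrite muln0.
- by rewrite card_prod.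
move=> [u v] /=; case: ifP => _; first by split.
case: ifP => _; first by split.
by case: ifP => _; split.
Qed.

Lemma runs_inverse M : posdef (mxV M) ->
  runs f (inverse M) (n * (n * n * 3).+1) 0 (fun N => mxV N = invmx (mxV M)).
Proof.
move=> Mp.
apply: (runs_weaken (t := size (enum V) * (n * n * 3).+1) (q := size (enum V) * 0)
  (P := fun N => forall x y, represents M x y <->
     represents N (exchange (enum V) x y) (exchange (enum V) y x))); first last.
- move=> N MN; apply: represents_invmx => x y; rewrite MN.
  by split; apply: represents_ext => v; rewrite /exchange mem_enum.
- by rewrite muln0.
- by rewrite -cardE.
apply: (runs_foldM (Inv := fun s N => forall x y, represents M x y <->
     represents N (exchange s x y) (exchange s y x))); last first.
  by move=> x y; split; apply: represents_ext.
move=> s1 k s2 N e MN; apply: runs_weaken (runs_pivot N k) _ _ _ => // _ -> x y.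
have ks : k \notin s1.
  have := enum_uniq V; rewrite e cat_uniq /= negb_or.
  by case/and3P => _ /andP[].
rewrite MN (represents_pivoted _ _ (lt0r_neq0 (pivot_gt0 Mp ks MN))).
by split; apply: represents_ext => v; rewrite /exchange mem_rcons !inE;
  case: eqVneq => [->|] //=; rewrite (negbTE ks).
Qed.
End LinearPrograms.

(** * The greedy routine and the sliding step *)
Section Greedy.
Variables (R : rcfType) (V : finType) (f : {set V} -> R).
Local Notation n := #|V|.
Implicit Types (mu : R) (S W : {set V}) (s : seq V) (w g : {ffun V -> R}).
Local Notation prefix s j := [set u in take j s].

Lemma runs_pick_order A (k : seq V -> prog R V A) t q P :
  (forall s, perm_eq s (enum V) -> runs f (k s) t q P) ->
  runs f (bind (pick_order R V) k) t q P.
Proof. by move=> h s sE; apply: h. Qed.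

(** Allows the value of the greedy point, known from [always_greedy_min], to be
    combined with a separate computation of its cost. *)
Lemma always_and A (p : prog R V A) (P P' : A -> nat -> nat -> Prop) :
  always f p P -> always f p P' -> always f p (fun a t q => P a t q /\ P' a t q).
Proof.
elim: p P P' => //= [o k IH|x y k IH|X k IH|k IH|k IH] P P' h h'.
- exact: IH.
- exact: IH.
- exact: IH.
- by move=> s sE; apply: IH; [exact: h|exact: h'].
- by move=> b; apply: IH; [exact: h|exact: h'].
Qed.

Lemma runs_shifted mu S : runs f (shifted mu S) 1 1 (fun a => a = shift f mu S).
Proof. by rewrite /shifted /shift; case: ifP. Qed.

Lemma ordering_uniq (s : seq V) : perm_eq s (enum V) -> uniq s.
Proof. by move=> sE; rewrite (perm_uniq sE) enum_uniq. Qed.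
Lemma mem_ordering (s : seq V) v : perm_eq s (enum V) -> v \in s.
Proof. by move=> sE; rewrite (perm_mem sE) mem_enum. Qed.
Lemma size_ordering (s : seq V) : perm_eq s (enum V) -> size s = n.
Proof. by move=> sE; rewrite (perm_size sE) cardE. Qed.

Lemma runs_greedy_min mu s : perm_eq s (enum V) ->
  runs f (greedy_min (shifted mu) s) (2 * n + 2) n.+1
    (fun x => x = greedy_point (shift f mu) s).
Proof.
move=> sE; have H := always_greedy_min (always_shifted f mu) sE.
suff : runs f (greedy_min (shifted mu) s) (2 * n + 2) n.+1 (fun=> True).
  by move=> /(always_and H); apply: always_impl => a t q [-> []].
apply: (runs_weaken (t := (size s * 2).+2) (q := (size s).+1) (P := fun=> True)) => //;
  [|by rewrite (size_ordering sE); lia|by rewrite (size_ordering sE)].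
apply: runs_bind_compute; apply: (runs_bind_le (t2 := (size s * 2)%N) (q2 := size s)
  (runs_shifted mu set0)) => // hP _.
elim: s {sE H} ([ffun=> _]) set0 hP => //= v s IH x P hP.
apply: (runs_bind_le (t2 := (size s * 2).+1%N) (q2 := size s)
  (runs_shifted mu _)) => // hv _.
by apply: runs_bind_compute; apply: IH.
Qed.

Lemma runs_min_set mu s :
  runs f (min_set (shifted mu) s) (size s * 3).+1 (size s).+1
    (fun W => (exists j, W = prefix s j) /\
              forall j, shift f mu W <= shift f mu (prefix s j)).
Proof.
apply: (runs_bind_le (t2 := (size s * 3)%N) (q2 := size s)
  (runs_shifted mu set0)) => // _ ->.
have gen s2 : forall s1 B, s = s1 ++ s2 -> (exists j, B = prefix s j) ->
    (forall j, (j <= size s1)%N -> shift f mu B <= shift f mu (prefix s j)) ->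
    runs f (min_set_from (shifted mu) B (shift f mu B) [set u in s1] s2)
      (size s2 * 3) (size s2)
      (fun W => (exists j, W = prefix s j) /\
              forall j, shift f mu W <= shift f mu (prefix s j)).
  elim: s2 => [|v s2 IH] s1 B e Bp Bmin /=.
    apply: runs_ret; split=> // j; have [jl|jl] := leqP j (size s1).
      exact: Bmin.
    move: Bmin; rewrite e cats0 => /(_ _ (leqnn _)).
    by rewrite take_size take_oversize // ltnW.
  apply: (runs_bind_le (t2 := (size s2 * 3).+2%N) (q2 := size s2)
    (runs_shifted mu _)) => // _ ->.
  apply: runs_bind_leq; apply: runs_bind_leq => b.
  have e' : s = rcons s1 v ++ s2 by rewrite cat_rcons.
  have eP : v |: [set u in s1] = [set u in rcons s1 v].
    by apply/setP=> u; rewrite !inE mem_rcons inE.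
  have eQ : [set u in rcons s1 v] = prefix s (size s1).+1.
    by rewrite e' take_size_cat // size_rcons.
  case: ifP => cond.
    rewrite eP; apply: IH => //; first by rewrite eQ; exists (size s1).+1.
    move=> j; rewrite size_rcons leq_eqVlt => /orP[/eqP ->|jl]; first by rewrite -eQ.
    case/andP: cond => le _; rewrite eP in le.
    exact: le_trans le (Bmin _ jl).
  rewrite eP; apply: IH => //.
  move=> j; rewrite size_rcons leq_eqVlt => /orP[/eqP ->|jl]; last exact: Bmin.
  move: cond; rewrite -eQ -eP; have [//|] := leP (shift f mu B) (shift f mu (v |: _)).
  by move=> /ltW ->.
rewrite -[set0](_ : [set u in [::]] = _); last by apply/setP=> u; rewrite !inE.
apply: gen => //; first by exists 0%N; rewrite take0.
by move=> j; rewrite leqn0 => /eqP ->; rewrite take0.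
Qed.

(** Stated for all pairs rather than for neighbours, so that it splits over
    concatenation. *)
Definition increasing (w : {ffun V -> R}) := pairwise (fun u v => w u <= w v).

Lemma runs_order_by w :
  runs f (order_by w) (n * n) 0 (fun s => perm_eq s (enum V) /\ increasing w s).
Proof.
apply: runs_pick_order => s sE.
have ins v r : increasing w r -> runs f (insert_by w v r) (size r) 0
    (fun r' => perm_eq r' (v :: r) /\ increasing w r').
  elim: r => [|u r IH] //= /andP[ur rw]; apply: runs_bind_leq.
  case: ifP => [vu|uv].
    apply: runs_ret; split=> //=; rewrite vu ur rw !andbT /=.
    by apply/allP => z /(allP ur); exact: le_trans.
  rewrite -[size r]addn0; apply: runs_bind (IH rw) _ => r' [pr rw'].
  apply: runs_ret; split.
    by rewrite -(perm_cons u) in pr; apply: (perm_trans pr); apply/permP => p; rewrite /= addnCA.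
  rewrite /= rw' andbT; apply/allP => z; rewrite (perm_mem pr) inE.
  by case/predU1P => [->|/(allP ur)//]; move/negbT: uv; rewrite -ltNge => /ltW.
suff: runs f (sort_by w s) (size s * size s) 0
    (fun s' => perm_eq s' s /\ increasing w s').
  move=> h; apply: (runs_weaken h); rewrite ?(size_ordering sE) //.
  by move=> s' [ps ->]; split=> //; apply: perm_trans sE.
elim: s {sE} => [|v s IH] //=.
apply: (runs_bind_le (t2 := size s) (q2 := 0) IH) => [|//|r [pr rw]].
  by case: (size s) => [//|m]; nia.
apply: runs_weaken (ins v r rw) _ _ _ => //; first by rewrite (perm_size pr).
by move=> r' [pr' ->]; split=> //; apply: perm_trans pr' _; rewrite perm_cons.
Qed.

Lemma greedy_point_cat (h : {set V} -> R) s1 v s2 : uniq (s1 ++ v :: s2) ->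
  greedy_point h (s1 ++ v :: s2) v = h [set u in rcons s1 v] - h [set u in s1].
Proof.
rewrite cat_uniq /= negb_or => /and3P[_ /andP[vs _] _].
rewrite ffunE index_cat (negbTE vs) /= eqxx addn0.
by rewrite (take_size_cat _ (erefl (size s1))) -cat_rcons take_size_cat // size_rcons.
Qed.

(** Summation by parts: w.g is the sum of h(P_i) (w(v_i) - w(v_{i+1})) over the
    proper nonempty prefixes P_i, and every w(v_i) - w(v_{i+1}) is nonpositive.
    Contrapositively, a positive w.g reveals a prefix of negative value, which is
    what triggers the slide. *)
Lemma greedy_dot_le0 (h : {set V} -> R) (w : {ffun V -> R}) s :
  perm_eq s (enum V) -> increasing w s -> h set0 = 0 -> h setT = 0 ->
  (forall j, 0 <= h (prefix s j)) ->
  \sum_v w v * greedy_point h s v <= 0.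
Proof.
move=> sE ws h0 hT hp; have us := ordering_uniq sE.
have nil0 : [set u in [::]] = set0 :> {set V} by apply/setP=> u; rewrite !inE.
have gen s2 : forall s1 c, s = s1 ++ s2 -> all (fun v => c <= w v) s2 ->
    \sum_(v <- s2) w v * greedy_point h s v <= - c * h [set u in s1].
  elim: s2 => [|v s2 IH] s1 c e.
    rewrite big_nil (_ : [set u in s1] = setT) ?hT ?mulr0 //.
    by apply/setP=> u; rewrite !inE -[s1]cats0 -e mem_ordering.
  case/andP=> cw _; rewrite big_cons.
  have wv : all (fun u => w v <= w u) s2.
    by move: ws; rewrite e /increasing pairwise_cat /= => /and3P[_ _ /andP[]].
  have /IH/(_ wv) : s = rcons s1 v ++ s2 by rewrite cat_rcons.
  have hP : 0 <= h [set u in s1] by have := hp (size s1); rewrite e take_size_cat.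
  rewrite {2}e greedy_point_cat -?e //.
  have : c * h [set u in s1] <= w v * h [set u in s1] by rewrite ler_wpM2r.
  rewrite mulrBr; lra.
case E: s => [|v0 s0].
  rewrite big1 // => v _; have := mem_ordering v sE; by rewrite E.
have := gen s [::] (w v0) (erefl _); rewrite nil0 h0 mulr0 -E => H.
rewrite -big_enum -(perm_big _ sE) /=; apply: H.
by move: ws; rewrite E /= lexx => /andP[].
Qed.
End Greedy.

Section Shift.
Variables (R : rcfType) (V : finType) (f : {set V} -> R).
Hypotheses (fsub : submodular f) (f0 : f set0 = 0).
Local Notation n := #|V|.
Implicit Types (mu : R) (S W : {set V}) (s : seq V) (w g : {ffun V -> R}).

Lemma shift0 mu : shift f mu set0 = 0. Proof. by rewrite /shift eqxx. Qed.
Lemma shiftT mu : shift f mu setT = 0. Proof. by rewrite /shift eqxx orbT. Qed.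

Lemma shift_le mu mu' S : mu <= mu' -> shift f mu S <= shift f mu' S.
Proof. by rewrite /shift; case: ifP => // _ h; rewrite lerD2l. Qed.

(** The condition mu >= max(0, - f(V)). *)
Definition admissible mu := 0 <= mu /\ 0 <= f setT + mu.

(** Only the empty set and V are affected by the exceptional values, and
    admissibility says that these values are below f + mu, which can only help on
    the smaller side of the inequality. *)
Lemma shift_submodular mu : admissible mu -> submodular (shift f mu).
Proof.
move=> [mu0 muT].
have le Z : shift f mu Z <= f Z + mu.
  rewrite /shift; case: eqVneq => [->|_] /=; first by rewrite f0 add0r.
  by case: eqVneq => [->|_].
move=> X Y.
have [->|X0] := eqVneq X set0; first by rewrite set0I set0U.
have [->|XT] := eqVneq X setT; first by rewrite setTI setTU addrC.
have [->|Y0] := eqVneq Y set0; first by rewrite setI0 setU0 addrC.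
have [->|YT] := eqVneq Y setT; first by rewrite setIT setUT.
apply: le_trans (lerD (le _) (le _)) _.
rewrite {1}/shift (negbTE X0) (negbTE XT) {1}/shift (negbTE Y0) (negbTE YT) /=.
by have := fsub X Y; lra.
Qed.

(** The points that Sliding von Neumann can have produced when its parameter has
    reached mu.  Allowing all earlier parameters makes the notion monotone in mu,
    so that points computed before a slide need no update. *)
Definition generator mu (g : {ffun V -> R}) := exists m s,
  [/\ admissible m, m <= mu, perm_eq s (enum V) & g = greedy_point (shift f m) s].

Lemma generator_mono mu mu' g : mu <= mu' -> generator mu g -> generator mu' g.
Proof.
by move=> le [m [s [ma mm sE ->]]]; exists m, s; split=> //; apply: le_trans le.
Qed.

Lemma generator_le mu g (S : {set V}) : generator mu g -> \sum_(v in S) g v <= shift f mu S.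
Proof.
move=> [m [s [ma mm sE ->]]]; apply: le_trans (shift_le S mm).
have [+ _] := greedy_base (shift_submodular ma) (shift0 m) (ordering_uniq sE)
  (fun v => mem_ordering v sE); exact.
Qed.

(** What [svn_step] needs from a slide in direction w = Q y. *)
Definition slide_post mu (w : {ffun V -> R}) (r : R * {set V} * {ffun V -> R}) :=
  let: (mu', W, g) := r in
  [/\ mu' = - f W, mu <= mu', exists2 s, perm_eq s (enum V) &
   g = greedy_point (shift f mu') s & \sum_v w v * g v <= 0].

(** Let d = - f_mu(W) > 0 for the minimizing prefix W.  Raising mu by d adds d to
    the values of all proper nonempty prefixes, so every prefix becomes
    nonnegative and [greedy_dot_le0] applies.  The greedy point for the same
    ordering changes only at v_1, where the preceding prefix is empty, and at
    v_n, where the prefix is V: these are the two corrections made by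
    [slide]. *)
Lemma runs_slide mu w s : admissible mu -> perm_eq s (enum V) -> increasing w s ->
  0 < \sum_v w v * greedy_point (shift f mu) s v ->
  runs f (slide mu s (greedy_point (shift f mu) s)) (3 * n).+4.+3 n.+3 (slide_post mu w).
Proof.
move=> mua sE ws pos; set g := greedy_point _ _ in pos *.
apply: runs_bind_compute.
have szn := size_ordering sE.
apply: (runs_bind_le (t2 := 5) (q2 := 2) (runs_min_set f mu s)) => [||W [Wp Wmin]].
- by lia.
- by lia.
apply: (runs_bind_le (t2 := 4) (q2 := 1) (runs_shifted f mu W)) => // _ ->.
apply: runs_bind_compute; apply: runs_bind_query; apply: runs_bind_compute.
have W_lt0 : shift f mu W < 0.
  rewrite ltNge; apply/negP => W0; move: pos; rewrite ltNge => /negP; apply.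
  apply: greedy_dot_le0; rewrite ?shift0 ?shiftT // => j.
  exact: le_trans W0 (Wmin j).
have [W0 WT] : W != set0 /\ W != setT.
  by split; apply: contraTneq W_lt0 => ->; rewrite ?shift0 ?shiftT ltxx.
have eW : shift f mu W = f W + mu by rewrite /shift (negbTE W0) (negbTE WT).
rewrite /= eW !sub0r; set d := - (f W + mu).
have dE : - f W = mu + d by rewrite /d; ring.
have d0 : 0 < d by rewrite /d oppr_gt0 -eW.
have shiftE X : X != set0 -> X != setT -> shift f (mu + d) X = shift f mu X + d.
  by move=> X0 XT; rewrite /shift (negbTE X0) (negbTE XT) addrA.
rewrite dE.
have fin g' : g' = greedy_point (shift f (mu + d)) s -> slide_post mu w (mu + d, W, g').
  move=> ->; split=> //; first by rewrite lerDl ltW.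
    by exists s.
  apply: greedy_dot_le0; rewrite ?shift0 ?shiftT // => j.
  have [->|X0] := eqVneq [set u in take j s] set0; first by rewrite shift0.
  have [->|XT] := eqVneq [set u in take j s] setT; first by rewrite shiftT.
  by rewrite shiftE // /d -eW subr_ge0.
have gE v : g v = shift f mu [set u in take (index v s).+1 s] -
    shift f mu [set u in take (index v s) s] by rewrite ffunE.
move: g gE pos => g gE _.
(* W is a proper nonempty prefix, so V has at least two elements and the
   corrections at v_1 and v_n do not interfere. *)
case Es: s => [|v1 [|v2 s2]].
- by case/set0Pn: W0 => v; have := mem_ordering v sE; rewrite Es.
- case: Wp => -[|j] WE.
    by move: W0; rewrite WE take0; case/set0Pn => v; rewrite inE.
  case/negP: WT; apply/eqP/setP=> v; rewrite WE Es /= inE [RHS]inE -Es.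
  exact: mem_ordering sE.
apply: runs_bind_compute; apply: runs_bind_compute; apply: runs_ret; apply: fin.
have us := ordering_uniq sE.
apply/ffunP=> v; rewrite !ffunE /=; set vn := last v2 s2.
have vs := mem_ordering v sE; pose i := index v s.
have is_ : (i < size s)%N by rewrite index_mem.
have nthi : nth v s i = v by rewrite nth_index.
have s0 : (0 < size s)%N by rewrite Es.
have vnE : (v == vn) = (i.+1 == size s).
  have -> : vn = nth v s (size s).-1 by rewrite nth_last Es.
  by rewrite -[X in X == _]nthi nth_uniq ?prednK // -eqSS prednK.
have v1E : (v == v1) = (i == 0%N).
  have -> : v1 = nth v s 0 by rewrite Es.
  by rewrite -[X in X == _]nthi nth_uniq.
(* i is the position of v, so v contributes the increment between the prefixes
   of lengths i and i + 1. *)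
have full j : [set u in take j s] = setT -> (size s <= j)%N.
  move/setP => h; rewrite leqNgt; apply/negP => js.
  have : nth v s j \in [set u in take j s] by rewrite h inE.
  rewrite inE => /(nthP v)[k]; rewrite size_take js => kj.
  rewrite nth_take // => /eqP; rewrite nth_uniq ?(ltn_trans kj) // => /eqP kj'.
  by rewrite kj' ltnn in kj.
have empty j : [set u in take j s] = set0 -> j = 0%N.
  move/setP/(_ v1); rewrite !inE; case: j => //= j.
  by rewrite Es inE eqxx.
have A : shift f (mu + d) [set u in take i.+1 s] =
    shift f mu [set u in take i.+1 s] + (if v == vn then 0 else d).
  rewrite vnE; case: eqP => [->|/eqP iN].
    rewrite take_size (_ : [set u in s] = setT) ?shiftT ?shiftT ?addr0 //.
    by apply/setP=> u; rewrite !inE (mem_ordering u sE).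
  apply: shiftE; first by apply/eqP => /empty.
  by apply/eqP => /full; rewrite leq_eqVlt eq_sym (negbTE iN) ltnNge is_.
have B : shift f (mu + d) [set u in take i s] =
    shift f mu [set u in take i s] + (if v == v1 then 0 else d).
  rewrite v1E; case: eqP => [->|/eqP iN].
    rewrite take0 (_ : [set u in Nil V] = set0) ?shift0 ?shift0 ?addr0 //.
  apply: shiftE; first by apply: contra iN => /eqP/empty ->.
  by apply/eqP => /full; rewrite leqNgt is_.
rewrite -/i A B.
have vn1 : vn != v1.
  have : v1 \notin v2 :: s2 by move: us; rewrite Es => /andP[].
  by apply: contraNneq => <-; rewrite mem_last.
case: (eqVneq v vn) => [vvn|vvn].
  by rewrite -vvn in vn1 *; rewrite (negbTE vn1) gE; ring.
by case: (eqVneq v v1) => [<-|vv1]; rewrite gE; ring.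
Qed.
End Shift.

(** * Sliding von Neumann *)
(** With a = |y|^2, b = |u|^2 <= 1 and c = y.u <= 0, the projection y' satisfies
    |y'|^2 = (a b - c^2) / (a - 2 c + b) <= a / (1 + a).  This raises 1/|y|^2 by at
    least 1, and the bound k |y|^2 <= 1 expresses the same without
    division. *)
Lemma von_neumann_step (R : realFieldType) n (Q : 'M[R]_n) y u (k : nat) :
  posdef Q -> 0 < bilin Q y y -> bilin Q y u <= 0 -> bilin Q u u <= 1 ->
  k%:R * bilin Q y y <= 1 ->
  let l := bilin Q (y - u) y / bilin Q (y - u) (y - u) in
  let y' := (1 - l) *: y + l *: u in
  [/\ 0 <= l, l <= 1 & k.+1%:R * bilin Q y' y' <= 1].
Proof.
move=> Qp; rewrite !(bilinDl, bilinDr, bilinNl, bilinNr, bilinZl, bilinZr) (bilinC u y Qp.1).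
have := posdef_ge0 u Qp.
set a := bilin Q y y; set b := bilin Q u u; set c := bilin Q y u => b0 a0 c0 b1 ka.
have -> : a - c + (- c - - b) = a - 2 * c + b by ring.
set D := a - 2 * c + b; have D0 : 0 < D by rewrite /D; lra.
have DN : D != 0 by rewrite gt_eqF.
move=> l /=; have lD : l * D = a - c by rewrite /l divfK.
split; first by rewrite divr_ge0 ?(ltW D0) //; lra.
  by rewrite ler_pdivrMr // /D; lra.
set q := (X in k.+1%:R * X).
have qE : q = (1 - l) * ((1 - l) * a + l * c) + l * ((1 - l) * c + l * b).
  by rewrite /q !(bilinDl, bilinDr, bilinZl, bilinZr) (bilinC u y Qp.1) -/a -/b -/c; ring.
have qD : q * D = a * b - c ^+ 2.
  have -> : q * D = a * D - 2 * (a - c) * (l * D) + (l * D) * (l * D).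
    by rewrite qE /D; ring.
  by rewrite lD /D; ring.
rewrite -(ler_pM2r D0) mul1r -mulrA qD.
have k0 : 0 <= k%:R :> R by [].
have : k%:R * a * b <= b by rewrite ler_piMl.
have : a * b <= a by rewrite ler_piMr // ltW.
have : 0 <= (k%:R + 1) * c ^+ 2 by rewrite mulr_ge0 ?sqr_ge0 // addr_ge0.
rewrite -natr1 /D; lra.
Qed.

Section Sliding.
Variables (R : rcfType) (V : finType) (f : {set V} -> R).
Hypothesis V0 : (0 < #|V|)%N.
Local Notation n := #|V|.
Local Notation state := (svn_state R V).
Implicit Types (mu : R) (S W : {set V}) (g : {ffun V -> R}) (Q : {ffun V * V -> R}).
Implicit Types (gens : seq ({ffun V -> R} * R)).

Definition qnorm Q g : R := Num.sqrt (bilin (mxV Q) (colv g) (colv g)).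

Lemma qnorm_sqr Q g : posdef (mxV Q) -> qnorm Q g ^+ 2 = bilin (mxV Q) (colv g) (colv g).
Proof. by move=> Qp; rewrite sqr_sqrtr ?posdef_ge0. Qed.

Lemma qnorm_gt0 Q g : posdef (mxV Q) -> colv g != 0 -> 0 < qnorm Q g.
Proof. by move=> Qp g0; rewrite sqrtr_gt0; apply: Qp.2. Qed.

(** The combination of normalized points that y stores in expanded form. *)
Definition weighted_sum Q gens : 'cV[R]_n :=
  \sum_(gx <- gens) (gx.2 / qnorm Q gx.1) *: colv gx.1.

(** [inv_size] is the convergence measure: each step adds one point, and
    [von_neumann_step] preserves the inequality. *)
Record svn_inv Q mu0 (st : state) : Prop := SvnInv {
  inv_mu : svn_mu st = - f (svn_W st);
  inv_adm : admissible f (svn_mu st);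
  inv_le : mu0 <= svn_mu st;
  inv_gen : forall gx, gx \in svn_gens st -> generator f (svn_mu st) gx.1;
  inv_pos : forall gx, gx \in svn_gens st -> 0 <= gx.2;
  inv_sum : \sum_(gx <- svn_gens st) gx.2 = 1;
  inv_y : colv (svn_y st) = weighted_sum Q (svn_gens st);
  inv_size : (size (svn_gens st))%:R * bilin (mxV Q) (colv (svn_y st)) (colv (svn_y st)) <= 1
}.

Lemma admissible_le mu mu' : mu <= mu' -> admissible f mu -> admissible f mu'.
Proof. by move=> le [h1 h2]; split; lra. Qed.

Lemma bilin_normalized Q g : posdef (mxV Q) ->
  bilin (mxV Q) ((qnorm Q g)^-1 *: colv g) ((qnorm Q g)^-1 *: colv g) <= 1.
Proof.
move=> Qp; rewrite bilinZl bilinZr -qnorm_sqr //; have [->|h] := eqVneq (qnorm Q g) 0.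
  by rewrite expr0n !mulr0.
by rewrite expr2 mulKf // mulVf.
Qed.

Lemma runs_svn_step Q mu0 (st : state) : posdef (mxV Q) -> svn_inv Q mu0 st ->
  0 < bilin (mxV Q) (colv (svn_y st)) (colv (svn_y st)) ->
  runs f (svn_step Q st) (11 * n * n + 23 * n + 27 + size (svn_gens st)) (2 * n + 4)
   (fun st' => svn_inv Q mu0 st' /\ size (svn_gens st') = (size (svn_gens st)).+1).
Proof.
case: st => mu W gens y Qp inv ypos.
have [imu iadm ile igen ipos isum iy isize] := inv.
rewrite /= in ypos imu iadm ile igen ipos isum iy isize.
rewrite -[size (svn_gens _)]/(size gens).
apply: (runs_bind_le (t2 := 9 * n * n + 22 * n + 26 + size gens) (q2 := 2 * n + 4)
  (runs_mulmv f Q y)) => [||w wE]; [by solve_cost|by solve_cost|].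
apply: (runs_bind_le (t2 := 8 * n * n + 22 * n + 26 + size gens) (q2 := 2 * n + 4)
  (runs_order_by f w)) => [||s [sE ws]]; [by solve_cost|by solve_cost|].
apply: (runs_bind_le (t2 := 8 * n * n + 20 * n + 24 + size gens) (q2 := n + 3)
  (runs_greedy_min f mu sE)) => [||_ ->]; [by solve_cost|by solve_cost|].
set g := greedy_point _ s.
apply: (runs_bind_le (t2 := (6 * n * n + 17 * n + 20 + size gens).+2) (q2 := n + 3)
  (runs_inner f Q y g)) => [||_ ->]; [by solve_cost|by solve_cost|].
apply: runs_bind_compute; apply: runs_bind_leq; rewrite ![eval _]/=.
(* The greedy direction w = Q y turns w.v into the Q-inner product with y. *)
have wg (v : {ffun V -> R}) : \sum_u w u * v u = bilin (mxV Q) (colv y) (colv v).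
  by rewrite -bilin1_colv wE /bilin mulmx1 trmx_mul Qp.1.
apply: (runs_bind_le (t1 := (3 * n).+4.+3) (q1 := n.+3)
  (t2 := 6 * n * n + 14 * n + 13 + size gens) (q2 := 0)
  (P := fun r => [/\ r.1.1 = - f r.1.2, mu <= r.1.1, generator f r.1.1 r.2 &
     bilin (mxV Q) (colv y) (colv r.2) <= 0])) => [|||[[mu' W'] g'] r];
  [|by solve_cost|by solve_cost|].
  case: leP => [le0|gt0].
    apply: runs_ret; split=> //=; exists mu, s; split=> //.
  rewrite -wg in gt0; apply: runs_weaken (runs_slide iadm sE ws gt0) _ _ _ => //.
  move=> [[mu' W'] g'] [e le [s' s'E g'E] wg']; split=> //; last by rewrite -wg.
  by exists mu', s'; split=> //; apply: admissible_le le iadm.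
have [mu'E mule geng' yg'] := r; rewrite /= in mu'E mule geng' yg'.
apply: (runs_bind_le (t2 := 4 * n * n + 10 * n + 9 + size gens) (q2 := 0)
  (runs_normalize f Q g')) => [||u uE]; [by solve_cost|by solve_cost|].
apply: (runs_bind_le (t2 := 4 * n * n + 9 * n + 8 + size gens) (q2 := 0)
  (runs_tabulate (fun v => runs_compute f (Defs.Sub (y v) (u v))))) => [||d dE];
  [by solve_cost|by solve_cost|].
have cd : colv d = colv y - colv u.
  by apply/matrixP => i j; rewrite dE !mxE ffunE.
apply: (runs_bind_le (t2 := 2 * n * n + 6 * n + 6 + size gens) (q2 := 0)
  (runs_inner f Q d y)) => [||_ ->]; [by solve_cost|by solve_cost|].
apply: (runs_bind_le (t2 := (3 * n + 1 + size gens).+3) (q2 := 0)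
  (runs_inner f Q d d)) => [||_ ->]; [by solve_cost|by solve_cost|].
do 3 apply: runs_bind_compute; rewrite ![eval _]/=.
rewrite cd; set l := _ / _.
have := von_neumann_step Qp ypos (u := colv u) (k := size gens) _ _ isize.
rewrite uE; move/(_ _ (bilin_normalized g' Qp)); rewrite -uE -/l => vn.
have {vn} [|l0 l1 ysize] := vn.
  by rewrite uE bilinZr mulr_ge0_le0 // invr_ge0 sqrtr_ge0.
apply: (runs_bind_le (t2 := size gens) (q2 := 0)
  (runs_tabulate (t := 3) (q := 0) (G := fun v => (1 - l) * y v + l * u v) _))
  => [//|||y' y'E]; [by solve_cost|by solve_cost|].
have cy' : colv y' = (1 - l) *: colv y + l *: colv u by rewrite y'E colv_lin.
rewrite -[X in runs _ _ X]addn0.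
apply: (runs_bind (t2 := 0) (q1 := 0) (q2 := 0)
  (P := fun r => r = [seq (gx.1, (1 - l) * gx.2) | gx <- gens])).
  rewrite -[X in runs _ _ X]muln1 -[X in runs _ _ _ X](muln0 (size gens)).
  apply: (runs_foldM (Inv := fun s r => r = [seq (gx.1, (1 - l) * gx.2) | gx <- s])) => //.
  move=> s1 gx s2 b _ ->; apply: runs_bind_compute; apply: runs_ret.
  by rewrite map_rcons.
move=> _ ->; apply: runs_ret.
set gens' := map _ _.
have lc : 0 <= 1 - l by rewrite subr_ge0.
split; last by rewrite /= size_rcons /gens' size_map.
split=> //=.
- exact: admissible_le mule iadm.
- exact: le_trans mule.
- move=> gx; rewrite mem_rcons inE => /predU1P[->//|/mapP[hx hxg ->]] /=.
  exact: generator_mono mule (igen _ hxg).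
- move=> gx; rewrite mem_rcons inE => /predU1P[->//|/mapP[hx hxg ->]] /=.
  by rewrite mulr_ge0 // ipos.
- by rewrite big_rcons /gens' big_map /= -mulr_sumr isum; ring.
- rewrite cy' iy /weighted_sum big_rcons /gens' /= big_map /= uE scalerA; congr (_ + _).
  rewrite scaler_sumr; apply: eq_bigr => gx _.
  by rewrite scalerA mulrA.
- by rewrite size_rcons /gens' size_map cy'.
Qed.

(** With K = 1/e^2 this turns the convergence measure into a bound on the number
    of steps made while the norm exceeds e. *)
Lemma few_generators (K k : nat) (e a : R) : 0 < e -> K%:R * e ^+ 2 = 1 ->
  e < a -> k%:R * a ^+ 2 <= 1 -> (k < K)%N.
Proof.
move=> e0 Ke ea; apply: contraTltn => Kk; rewrite -ltNge.
have a0 : 0 < a by exact: lt_trans ea.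
have K0 : 0 < K%:R :> R.
  by rewrite lt0r ler0n andbT; apply/eqP => K0; move/eqP: Ke; rewrite K0 mul0r eq_sym oner_eq0.
have : K%:R * e ^+ 2 < k%:R * a ^+ 2.
  apply: (@lt_le_trans _ _ (K%:R * a ^+ 2)).
    by rewrite ltr_pM2l // ltr_pXn2r ?nnegrE ?ltW.
  by rewrite ler_wpM2r ?sqr_ge0 ?ler_nat.
by rewrite Ke.
Qed.

(** The fuel suffices because each step consumes one unit and adds one point,
    while the loop only continues with fewer than 400 n^2 points. *)
Lemma runs_svn_loop fuel Q mu0 eps (st : state) : posdef (mxV Q) -> 0 < eps ->
  (400 * n * n)%:R * eps ^+ 2 = 1 -> (400 * n * n <= fuel + size (svn_gens st))%N ->
  (size (svn_gens st) <= 400 * n * n)%N ->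
  svn_inv Q mu0 st ->
  runs f (svn_loop fuel Q eps st) (470 * n * n * fuel.+1) (6 * n * fuel)
   (fun st' => [/\ svn_inv Q mu0 st', qnorm Q (svn_y st') <= eps &
                  (size (svn_gens st') <= 400 * n * n)%N]).
Proof.
move=> Qp e0 e2; elim: fuel st => [|fuel IH] st hf hs inv /=.
  apply: (runs_bind_le (t2 := 1) (q2 := 0) (runs_normQ f Q _)) => [||_ ->];
    [by solve_cost|by solve_cost|].
  apply: runs_bind_leq; case: leP => [le|gt]; first by apply: runs_ret.
  have := inv_size inv; rewrite -qnorm_sqr // => /(few_generators e0 e2 gt).
  by rewrite ltnNge hf.
apply: (runs_bind_le (t2 := (461 * n * n + 470 * n * n * fuel.+1).+1) (q2 := 6 * n * fuel.+1)
  (runs_normQ f Q _)) => [||_ ->]; [by solve_cost|by solve_cost|].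
apply: runs_bind_leq; case: leP => [le|gt]; first by apply: runs_ret.
have ypos : 0 < bilin (mxV Q) (colv (svn_y st)) (colv (svn_y st)).
  by rewrite -sqrtr_gt0; exact: lt_trans gt.
have hs' : (size (svn_gens st) < 400 * n * n)%N.
  by have := inv_size inv; rewrite -qnorm_sqr // => /(few_generators e0 e2 gt).
apply: (runs_bind_le (t2 := 470 * n * n * fuel.+1) (q2 := 6 * n * fuel)
  (runs_svn_step Qp inv ypos)) => [||st' [inv' sz']]; [by move: hs'; solve_cost|by solve_cost|].
by apply: IH; rewrite ?sz' ?addnS.
Qed.

(** At most 400 n^2 steps, each of at most 470 n^2 operations including the
    rescaling of up to 400 n^2 coefficients; the lower-order terms of
    initialization and of the last test fit in the difference between 470 and
    500. *)
Lemma runs_sliding_von_neumann mu W Q eps : posdef (mxV Q) -> 0 < eps ->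
  (400 * n * n)%:R * eps ^+ 2 = 1 -> mu = - f W -> admissible f mu ->
  runs f (sliding_von_neumann (400 * n * n) mu W Q eps)
   (500 * 400 * n ^ 4) (2500 * n ^ 3)
   (fun st' => [/\ svn_inv Q mu st', qnorm Q (svn_y st') <= eps &
                  (size (svn_gens st') <= 400 * n * n)%N]).
Proof.
move=> Qp e0 e2 muE adm.
apply: (runs_bind_le (t1 := 2 * n + 2) (q1 := n.+1)
  (t2 := 2 * n * n + 4 * n + 5 + 470 * n * n * (400 * n * n).+1)
  (q2 := 6 * n * (400 * n * n)) (P := generator f mu)).
- apply: runs_pick_order => s sE.
  apply: runs_weaken (runs_greedy_min f mu sE) _ _ _ => // _ ->.
  by exists mu, s.
- have n1 := V0; have n2 : (n <= n * n)%N by rewrite leq_pmulr.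
  have n4 : (n * n <= n * n * n * n)%N by rewrite -mulnA leq_pmulr // muln_gt0 V0.
  rewrite !expnS expn0; move: n1 n2 n4; move: #|_| => m; nia.
- have n1 := V0; have n2 : (n <= n * n * n)%N by rewrite -mulnA leq_pmulr // muln_gt0 V0.
  rewrite !expnS expn0; move: n1 n2; move: #|_| => m; nia.
move=> g gg.
apply: (runs_bind_le (t2 := (470 * n * n * (400 * n * n).+1).+1)
  (q2 := 6 * n * (400 * n * n)) (runs_normalize f Q g)) => [||y yE].
- by solve_cost.
- by solve_cost.
apply: runs_bind_compute; apply: runs_svn_loop => //=.
- by solve_cost.
- by solve_cost.
split=> //=.
- by move=> gx; rewrite inE => /eqP ->.
- by move=> gx; rewrite inE => /eqP ->.
- by rewrite big_seq1.
- by rewrite /weighted_sum big_seq1 /= mul1r.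
- by rewrite yE mul1r; apply: bilin_normalized.
Qed.
End Sliding.

(** * Rescaling *)
(** Bernoulli's inequality for bases below 1. *)
Lemma bernoulli_sub (R : realDomainType) (x : R) n : 0 <= x -> x <= 1 ->
  1 - n%:R * x <= (1 - x) ^+ n.
Proof.
move=> x0 x1; elim: n => [|n IH]; first by rewrite mul0r subr0 expr0.
have : (1 - n%:R * x) * (1 - x) <= (1 - x) ^+ n.+1.
  by rewrite exprSr ler_wpM2r // subr_ge0.
apply: le_trans; rewrite -natr1.
have : 0 <= n%:R * (x * x) by rewrite mulr_ge0 // mulr_ge0.
nra.
Qed.

Section Rescaling.
Variables (R : rcfType) (V : finType) (f : {set V} -> R).
Hypotheses (fsub : submodular f) (f0 : f set0 = 0) (V0 : (0 < #|V|)%N).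
Local Notation n := #|V|.
Implicit Types (mu : R) (S W : {set V}) (g : {ffun V -> R}) (Q M : {ffun V * V -> R}).
Implicit Types (gens : seq ({ffun V -> R} * R)) (gx : {ffun V -> R} * R) (e : R).

(** The matrix R + sum_i x_i g_i g_i^T / ||g_i||_Q^2 of the rescaling step, before
    its division by (1 + eps)^2. *)
Definition updated Q gens (A : 'M[R]_n) : 'M[R]_n :=
  A + \sum_(gx <- gens) (gx.2 / qnorm Q gx.1 ^+ 2) *: (colv gx.1 *m (colv gx.1)^T).

Definition shrink_factor (e : R) : R := 1 / ((1 + e) * (1 + e)).

Lemma shrink_factor_gt0 e : 0 < e -> 0 < shrink_factor e.
Proof. by move=> e0; rewrite divr_gt0 // mulr_gt0 // addr_gt0. Qed.

(** The loss of determinant caused by the scaling: (1 + e)^-2 >= 1 - 2 e and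
    Bernoulli's inequality with 2 e n = 1/10. *)
Lemma shrink_factor_exp_ge e : 0 < e -> n%:R * e = 20^-1 -> 9 / 10 <= shrink_factor e ^+ n.
Proof.
move=> e0 ne; have n1 : 1 <= n%:R :> R by rewrite ler1n.
have e1 : e <= 20^-1 by rewrite -ne ler_peMl // ltW.
have h : 1 - 2 * e <= shrink_factor e.
  rewrite /shrink_factor ler_pdivlMr; last by rewrite mulr_gt0 // addr_gt0.
  have -> : (1 - 2 * e) * ((1 + e) * (1 + e)) = 1 - (3 * (e * e) + 2 * (e * (e * e))).
    by ring.
  by rewrite gerBl addr_ge0 // mulr_ge0 // ltW // !mulr_gt0.
apply: (@le_trans _ _ ((1 - 2 * e) ^+ n)).
  have := @bernoulli_sub R (2 * e) n; rewrite mulrCA ne => b.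
  by apply: le_trans (b _ _); lra.
by rewrite lerXn2r // nnegrE ?(ltW (shrink_factor_gt0 e0)) //; lra.
Qed.

(** Defined from all generators for mu instead of those actually computed, so that
    it depends on mu alone and shrinks as mu grows. *)
Definition polar_cone mu (p : 'cV[R]_n) := forall g, generator f mu g -> bilin 1%:M p (colv g) <= 0.

Lemma polar_cone_mono mu mu' p : mu <= mu' -> polar_cone mu' p -> polar_cone mu p.
Proof. by move=> le c g /(generator_mono le); apply: c. Qed.

Section Round.
Variables (A : 'M[R]_n) (Q : {ffun V * V -> R}) (gens : seq ({ffun V -> R} * R)).
Hypotheses (Ap : posdef A) (QA : mxV Q = invmx A).
Hypothesis pos : forall gx, gx \in gens -> 0 <= gx.2.

Let Qp : posdef (mxV Q). Proof. by rewrite QA; apply: posdef_inv. Qed.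

Let w_ge0 gx : gx \in gens -> 0 <= gx.2 / qnorm Q gx.1 ^+ 2.
Proof. by move=> gg; rewrite divr_ge0 ?pos ?sqr_ge0. Qed.

Lemma updated_posdef : posdef (updated Q gens A).
Proof. exact: posdef_update. Qed.

Lemma dual_bound (p g : 'cV[R]_n) : bilin 1%:M p g <= 0 ->
  - bilin 1%:M p g <= Num.sqrt (bilin A p p) * Num.sqrt (bilin (mxV Q) g g).
Proof.
move=> pg; rewrite -(@ler_pXn2r _ 2) ?nnegrE ?oppr_ge0 ?mulr_ge0 ?sqrtr_ge0 //.
rewrite exprMn !sqr_sqrtr ?posdef_ge0 // sqrrN QA.
exact: bilin_cauchy_dual.
Qed.

(** Put t_i = - p.g_i / ||g_i||_Q.  Then 0 <= t_i <= ||p||_R by duality, and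
    sum_i x_i t_i = - p.y <= eps ||p||_R since ||y||_Q <= eps.  Therefore
    sum_i x_i t_i^2 <= eps ||p||_R^2, and the new squared norm is at most
    (1 + eps) / (1 + eps)^2 times the old one. *)
Lemma updated_cone e (p : 'cV[R]_n) : 0 < e -> \sum_(gx <- gens) gx.2 = 1 ->
  Num.sqrt (bilin (mxV Q) (weighted_sum Q gens) (weighted_sum Q gens)) <= e ->
  (forall gx, gx \in gens -> bilin 1%:M p (colv gx.1) <= 0) ->
  bilin (shrink_factor e *: updated Q gens A) p p <= bilin A p p.
Proof.
move=> e0 sum1 ye pg; set N := Num.sqrt (bilin A p p).
have N0 : 0 <= N by exact: sqrtr_ge0.
have N2 : N * N = bilin A p p by rewrite -expr2 sqr_sqrtr // posdef_ge0.
pose t gx : R := - bilin 1%:M p (colv gx.1) / qnorm Q gx.1.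
have t0 gx : gx \in gens -> 0 <= t gx.
  by move=> /pg h; rewrite divr_ge0 ?oppr_ge0 ?sqrtr_ge0.
have tN gx : gx \in gens -> t gx <= N.
  move=> /pg h; rewrite /t; have [->|nz] := eqVneq (qnorm Q gx.1) 0.
    by rewrite invr0 mulr0.
  have : 0 < qnorm Q gx.1 by rewrite lt0r nz sqrtr_ge0.
  by move=> n0; rewrite ler_pdivrMr //; apply: dual_bound.
have sum_t : \sum_(gx <- gens) gx.2 * t gx <= N * e.
  have -> : \sum_(gx <- gens) gx.2 * t gx = - bilin 1%:M p (weighted_sum Q gens).
    rewrite /weighted_sum bilin_sumr -sumrN; apply: eq_bigr => gx _.
    by rewrite bilinZr /t; ring.
  apply: le_trans (dual_bound _) _; last by rewrite ler_wpM2l.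
  rewrite /weighted_sum bilin_sumr big_seq sumr_le0 // => gx gg.
  by rewrite bilinZr mulr_ge0_le0 ?pg // divr_ge0 ?pos ?sqrtr_ge0.
have sum_t2 : bilin (\sum_(gx <- gens) (gx.2 / qnorm Q gx.1 ^+ 2) *:
     (colv gx.1 *m (colv gx.1)^T)) p p <= N * (N * e).
  rewrite bilin_summ; apply: le_trans (_ : N * (\sum_(gx <- gens) gx.2 * t gx) <= _).
    rewrite mulr_sumr !big_seq; apply: ler_sum => gx gg.
    have -> : bilin ((gx.2 / qnorm Q gx.1 ^+ 2) *: (colv gx.1 *m (colv gx.1)^T)) p p =
        t gx * (gx.2 * t gx).
      rewrite bilinZm bilin_rank1 (bilinC (colv gx.1) p (trmx1 _ _)) /t -exprVn.
      by ring.
    by rewrite ler_wpM2r ?tN // mulr_ge0 ?pos ?t0.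
  by rewrite ler_wpM2l.
rewrite bilinZm bilinDm -N2 /shrink_factor mul1r ler_pdivrMl; last by rewrite mulr_gt0 // addr_gt0.
have : 0 <= N * N * (e + e * e) by rewrite mulr_ge0 ?mulr_ge0 // addr_ge0 ?mulr_ge0 // ltW.
rewrite -/N in N2 *; nra.
Qed.

(** The rank-one terms have total trace sum_i x_i = 1 relative to A, so they at
    least double the determinant; then 2 * 9/10 = 9/5. *)
Lemma updated_det e : 0 < e -> n%:R * e = 20^-1 -> 0 <= \det A ->
  \sum_(gx <- gens) gx.2 = 1 -> (forall gx, gx \in gens -> colv gx.1 != 0) ->
  9 / 5 * \det A <= \det (shrink_factor e *: updated Q gens A).
Proof.
move=> e0 ne dA sum1 nz; rewrite detZ.
have h : 2 * \det A <= \det (updated Q gens A).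
  apply: le_trans (det_update_ge (c := fun gx => gx.2 / qnorm Q gx.1 ^+ 2)
    (fun gx => colv gx.1) Ap dA w_ge0).
  rewrite mulrC ler_wpM2l // -QA; rewrite le_eqVlt; apply/orP; left; apply/eqP.
  congr (1 + _); rewrite -sum1 !big_seq; apply: eq_bigr => gx gg.
  by rewrite -qnorm_sqr // divfK // expf_neq0 // gt_eqF // qnorm_gt0 // nz.
have := shrink_factor_exp_ge e0 ne; set c := _ ^+ _ => cge.
have : 0 <= (c - 9 / 10) * \det (updated Q gens A).
  by rewrite mulr_ge0 ?subr_ge0 // (le_trans _ h) // mulr_ge0.
nra.
Qed.
End Round.

Definition indicator S : {ffun V -> R} := [ffun v => (v \in S)%:R].

Lemma bilin1_indicator S g : bilin 1%:M (colv (indicator S)) (colv g) = \sum_(v in S) g v.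
Proof.
rewrite bilin1_colv [RHS]big_mkcond; apply: eq_bigr => v _; rewrite ffunE.
by case: (v \in S); rewrite ?mul1r ?mul0r.
Qed.

Lemma improving_proper mu W S : admissible f mu -> mu = - f W -> f S < f W ->
  S != set0 /\ S != setT.
Proof.
move=> [m0 mT] muE SW; split; apply: contraTneq SW => ->; rewrite -leNgt.
  by rewrite f0 -oppr_ge0 -muE.
by move: mT; rewrite muE subr_ge0.
Qed.

(** The separation property: a set better than W is separated from the origin
    by every generator simultaneously. *)
Lemma improving_generator mu W S g : admissible f mu -> mu = - f W -> f S < f W ->
  generator f mu g -> \sum_(v in S) g v <= f S - f W.
Proof.
move=> adm muE SW /(generator_le fsub f0) h.
have [S0 ST] := improving_proper adm muE SW.
by have := h S; rewrite /shift (negbTE S0) (negbTE ST) /= muE.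
Qed.

Lemma improving_neq0 mu W S g : admissible f mu -> mu = - f W -> f S < f W ->
  generator f mu g -> colv g != 0.
Proof.
move=> adm muE SW gg; have := improving_generator adm muE SW gg.
apply: contraTneq => g0; rewrite -ltNge -bilin1_indicator g0 bilin0r.
by rewrite subr_lt0.
Qed.

(** Evaluated at the indicator of S, all terms of the combination are nonpositive
    and a term vanishes only if its coefficient does; the coefficients sum
    to 1. *)
Lemma improving_weighted_sum_neq0 Q mu0 (st : svn_state R V) S : posdef (mxV Q) ->
  svn_inv f Q mu0 st -> f S < f (svn_W st) -> colv (svn_y st) != 0.
Proof.
move=> Qp inv SW; apply/eqP => y0.
have : bilin 1%:M (colv (indicator S)) (weighted_sum Q (svn_gens st)) = 0.
  by rewrite -(inv_y inv) y0 bilin0r.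
rewrite /weighted_sum bilin_sumr => H.
have le0 gx : gx \in svn_gens st -> bilin 1%:M (colv (indicator S)) (colv gx.1) < 0.
  move=> gg; rewrite bilin1_indicator; apply: le_lt_trans
    (improving_generator (inv_adm inv) (inv_mu inv) SW (inv_gen inv gg)) _.
  by rewrite subr_lt0.
have np gx : gx \in svn_gens st -> 0 < qnorm Q gx.1.
  move=> gg; apply: qnorm_gt0 => //.
  exact: improving_neq0 (inv_adm inv) (inv_mu inv) SW (inv_gen inv gg).
have z gx : gx \in svn_gens st -> gx.2 = 0.
  move=> gg; apply/eqP; rewrite eq_le (inv_pos inv gg) andbT.
  have t_ge0 hx : hx \in svn_gens st ->
      0 <= - bilin 1%:M (colv (indicator S)) ((hx.2 / qnorm Q hx.1) *: colv hx.1).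
    move=> hg; rewrite oppr_ge0 bilinZr mulr_ge0_le0 ?(ltW (le0 _ hg)) //.
    by rewrite divr_ge0 ?(inv_pos inv) // sqrtr_ge0.
  have : - bilin 1%:M (colv (indicator S)) ((gx.2 / qnorm Q gx.1) *: colv gx.1) = 0.
    apply/eqP; move: H => /eqP; rewrite -oppr_eq0 -sumrN big_seq.
    rewrite psumr_eq0 // => /allP /(_ _ gg); by rewrite gg.
  move/eqP; rewrite oppr_eq0 bilinZr !mulf_eq0 invr_eq0 (gt_eqF (np _ gg)).
  by rewrite (lt_eqF (le0 _ gg)) !orbF => /eqP ->.
have := inv_sum inv; rewrite big_seq big1 // => /eqP.
by rewrite eq_sym oner_eq0.
Qed.

Lemma runs_identity : runs f (identity R V) (n * n).+1 0 (fun Q => mxV Q = 1%:M).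
Proof.
apply: (runs_weaken (runs_tabulate (fun uv => runs_compute f (Const (uv.1 == uv.2))))).
- by rewrite card_prod muln1.
- by rewrite muln0.
move=> _ ->; apply/matrixP => i j; rewrite !mxE ffunE /=.
by rewrite (inj_eq enum_val_inj).
Qed.

Lemma runs_is_zero (y : {ffun V -> R}) :
  runs f (is_zero y) (2 * n).+1 0 (fun b => b = (colv y == 0)).
Proof.
apply: runs_bind_compute.
apply: (runs_weaken (t := size (enum V) * 2) (q := size (enum V) * 0)
  (P := fun b => b = all (fun v => y v == 0) (enum V))).
- apply: (runs_foldM (Inv := fun s b => b = all (fun v => y v == 0) s)) => //.
  move=> s1 v s2 b _ ->; apply: runs_bind_leq; apply: runs_bind_leq; apply: runs_ret.
  by rewrite all_rcons eq_le andbC.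
- by rewrite -cardE mulnC.
- by rewrite muln0.
move=> _ ->; apply/allP/eqP => [h|h v _].
  by apply/matrixP => i j; rewrite !mxE; apply/eqP/h; rewrite mem_enum.
by have /matrixP/(_ (enum_rank v) 0) := h; rewrite !mxE enum_rankK => ->.
Qed.

Lemma runs_rescale e Q M gens : posdef (mxV Q) -> 
  runs f (rescale e Q M gens)
    (size gens * (5 * n * n + 3 * n + 4) + n * n + 5) 0
    (fun M' => mxV M' = shrink_factor e *: updated Q gens (mxV M)).
Proof.
move=> Qp.
apply: (runs_bind_le (t1 := size gens * (5 * n * n + 3 * n + 4)) (q1 := size gens * 0)
  (t2 := (n * n).+4.+1) (q2 := 0) (P := fun M' => mxV M' = updated Q gens (mxV M))).
- apply: (runs_foldM (Inv := fun s M' => mxV M' = updated Q s (mxV M))); last first.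
    by rewrite /updated big_nil addr0.
  move=> s1 [g x] s2 M' _ M'E.
  apply: (runs_bind_le (t2 := (3 * n * n).+2) (q2 := 0) (runs_inner f Q g g)) => [||_ ->];
    [by solve_cost|by solve_cost|].
  apply: runs_bind_compute; apply: runs_weaken (runs_tabulate (t := 3) (q := 0)
    (G := fun uv => M' uv + x / bilin (mxV Q) (colv g) (colv g) * (g uv.1 * g uv.2)) _) _ _ _.
  + by move=> uv; split=> //=; rewrite addrC.
  + by rewrite card_prod; solve_cost.
  + by rewrite muln0.
  move=> _ ->; rewrite /updated big_rcons addrA /= -/(updated Q s1 (mxV M)) -M'E.
  apply/matrixP => i j; rewrite !mxE ffunE big_ord1 !mxE qnorm_sqr //=.
- by solve_cost.
- by rewrite muln0.
move=> M' M'E; do 4 apply: runs_bind_compute.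
apply: runs_weaken (runs_tabulate (fun uv => runs_compute f _)) _ _ _.
- by rewrite card_prod muln1.
- by rewrite muln0.
by move=> _ ->; apply/matrixP => i j; rewrite -M'E !mxE ffunE.
Qed.

(** The state after t rounds, with A standing for R.  The determinant bound is
    conditional on W not being optimal: only then are the generators nonzero.  It
    is inherited by later rounds because a set better than the current W is
    also better than all earlier ones. *)
Record loop_inv t (A : 'M[R]_n) mu W : Prop := LoopInv {
  linv_posdef : posdef A;
  linv_mu : mu = - f W;
  linv_adm : admissible f mu;
  linv_cone : forall p, polar_cone mu p -> bilin A p p <= bilin 1%:M p p;
  linv_det : forall S, f S < f W -> (9 / 5) ^+ t <= \det A
}.

Definition minimizer W := forall S, f W <= f S.

(** Either some round stopped with y = 0, and its W is a minimizer, or the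
    invariant holds after all T rounds.  Each round has 500 * 400 n^4 operations
    for Sliding von Neumann and a further 500 * 10 n^4 for adding up to 400 n^2
    rank-one terms and inverting the sum. *)
Lemma runs_rescaling_loop e T t Q M Gamma mu W : 0 < e -> n%:R * e = 20^-1 ->
  loop_inv t (mxV M) mu W -> mxV Q = invmx (mxV M) ->
  runs f (rescaling_loop (400 * n * n) T e Q M Gamma mu W)
    (T * (500 * 410 * n ^ 4)) (T * (2500 * n ^ 3))
    (fun W' => minimizer W' \/ exists A mu', loop_inv (t + T) A mu' W').
Proof.
(* 400 n^2 = 1 / e^2. *)
move=> e0 ne; have e2 : (400 * n * n)%:R * e ^+ 2 = 1.
  have -> : (400 * n * n)%:R * e ^+ 2 = 400 * (n%:R * e) ^+ 2.
    by rewrite !natrM exprMn; ring.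
  by rewrite ne; field.
elim: T t Q M Gamma mu W => [|T IH] t Q M Gamma mu W inv QM.
  by apply: runs_ret; right; exists (mxV M), mu; rewrite addn0.
have [Mp muE adm icone idet] := inv.
have Qp : posdef (mxV Q) by rewrite QM; apply: posdef_inv.
have n1 := V0; have n2 : (n <= n * n * n * n)%N.
  by rewrite -!mulnA leq_pmulr // !muln_gt0 V0.
have n3 : (n * n <= n * n * n * n)%N by rewrite -[X in (_ <= X)%N]mulnA leq_pmulr // muln_gt0 V0.
have n4 : (n * n * n <= n * n * n * n)%N by rewrite leq_pmulr.
apply: (runs_bind_le (t2 := 500 * 10 * n ^ 4 + T * (500 * 410 * n ^ 4))
  (q2 := T * (2500 * n ^ 3)) (runs_sliding_von_neumann V0 Qp e0 e2 muE adm))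
  => [||st [sinv small few]].
- by solve_cost.
- by solve_cost.
case: st sinv small few => mu' W' gens y sinv small few0.
have {few0} few : (size gens <= 400 * n * n)%N by [].
apply: (runs_bind_le (t2 := size gens * (5 * n * n + 3 * n + 4) + n * n + 5 +
    n * (n * n * 3).+1 + T * (500 * 410 * n ^ 4))
  (q2 := T * (2500 * n ^ 3)) (runs_is_zero y)) => [||_ ->].
- move: few n1 n2 n3 n4; rewrite !expnS expn0.
  have : (size gens <= 400 * n * n -> size gens * (5 * n * n + 3 * n + 4) <=
    400 * n * n * (5 * n * n + 3 * n + 4))%N by move=> h; rewrite leq_mul2r h orbT.
  move: (size gens) => k; move: #|_| => m h1 h2; move: (h1 h2).
  nia.
- by solve_cost.
case: eqP => [y0|_].
  apply: runs_ret; left => S; rewrite leNgt; apply/negP => SW.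
  by have := improving_weighted_sum_neq0 Qp sinv SW; rewrite /= y0 eqxx.
apply: (runs_bind_le (t2 := n * (n * n * 3).+1 + T * (500 * 410 * n ^ 4))
  (q2 := T * (2500 * n ^ 3)) (runs_rescale e M gens Qp)) => [||M' M'E].
- by solve_cost.
- by solve_cost.
have [smu sadm sle sgen spos ssum sy ssize] := sinv.
rewrite /= in smu sadm sle sgen spos ssum sy ssize small.
have Up := updated_posdef Q Mp spos.
have M'p : posdef (mxV M') by rewrite M'E; apply: posdef_scale; rewrite ?shrink_factor_gt0.
apply: (runs_bind_le (t2 := T * (500 * 410 * n ^ 4))
  (q2 := T * (2500 * n ^ 3)) (runs_inverse f M'p)) => [||Q' Q'E].
- by solve_cost.
- by solve_cost.
rewrite addnS -addSn; apply: IH => //; split=> //.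
- move=> p pc; apply: le_trans (icone p (polar_cone_mono sle pc)); rewrite M'E.
  apply: updated_cone => //; first by rewrite -sy.
  by move=> gx /sgen; apply: pc.
- move=> S SW; rewrite M'E exprS.
  have SW0 : f S < f W.
    by apply: lt_le_trans SW _; rewrite -lerN2 -muE -smu.
  have d := idet S SW0.
  apply: le_trans (updated_det Mp QM spos e0 ne _ ssum _).
  + by rewrite ler_wpM2l // divr_ge0.
  + by apply: le_trans d; rewrite exprn_ge0 // divr_ge0.
  + by move=> gx /sgen; apply: (improving_neq0 sadm smu SW).
Qed.
End Rescaling.

(** * Upper bound on the determinant and conclusion *)
Section Bounds.
Variables (R : rcfType) (V : finType) (f : {set V} -> R) (L : R).
Hypotheses (fsub : submodular f) (f0 : f set0 = 0) (Lmax : is_max_norm2 f L).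
Local Notation n := #|V|.
Implicit Types (mu G : R) (S W : {set V}) (g z : {ffun V -> R}) (s : seq V).

Lemma greedy_norm s : perm_eq s (enum V) -> norm2 (greedy_point f s) <= L.
Proof.
move=> sE; case: Lmax => _ Lub; have B :=
  greedy_base fsub f0 (ordering_uniq sE) (fun v => mem_ordering v sE).
exact: (Lub _ B).
Qed.

Lemma entry_le_norm2 z v : `|z v| <= norm2 z.
Proof.
rewrite -sqrtr_sqr ler_wsqrtr // (bigD1 v) //= lerDl sumr_ge0 // => u _.
exact: sqr_ge0.
Qed.

(** Cauchy-Schwarz against the indicator of S. *)
Lemma sum_le_norm2 z S : `|\sum_(v in S) z v| <= Num.sqrt n%:R * norm2 z.
Proof.
rewrite -sqrtr_sqr /norm2 -sqrtrM // ler_wsqrtr // -bilin1_indicator.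
apply: le_trans (bilin_cauchy _ _ (posdef1 _ _)) _.
rewrite !bilin1_colv (_ : \sum_v z v * z v = \sum_v z v ^+ 2) //.
apply: ler_wpM2r; first by apply: sumr_ge0 => v _; exact: sqr_ge0.
rewrite cardE -sum1_size natr_sum big_enum.
by apply: ler_sum => v _; rewrite ffunE; case: (v \in S); rewrite ?mulr1 ?mulr0 ?ler01.
Qed.

(** Listing the elements of W first makes W a prefix, and greedy points are tight
    on prefixes.  This expresses values of f through points of B(f), hence
    bounds them in terms of L. *)
Lemma tight_ordering W : exists2 s, perm_eq s (enum V) &
  \sum_(v in W) greedy_point f s v = f W.
Proof.
pose s := enum W ++ enum (~: W).
have sE : perm_eq s (enum V).
  apply: uniq_perm; rewrite ?enum_uniq //.
    rewrite cat_uniq !enum_uniq andbT /= -all_predC; apply/allP => v.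
    by rewrite /= !mem_enum inE.
  by move=> v; rewrite mem_cat !mem_enum !inE orbN.
exists s => //.
have WE : [set u in take (size (enum W)) s] = W.
  by rewrite take_size_cat //; apply/setP => v; rewrite inE mem_enum.
by have := greedy_prefix f0 (size (enum W)) (ordering_uniq sE) (fun v => mem_ordering v sE);
   rewrite WE.
Qed.

Lemma abs_value_le S : `|f S| <= Num.sqrt n%:R * L.
Proof.
have [s sE <-] := tight_ordering S; apply: le_trans (sum_le_norm2 _ _) _.
by rewrite ler_wpM2l ?sqrtr_ge0 ?greedy_norm.
Qed.

Lemma covalue_le W : f setT - f W <= Num.sqrt n%:R * L.
Proof.
have [s sE sW] := tight_ordering W; rewrite -sW.
have [_ <-] := greedy_base fsub f0 (ordering_uniq sE) (fun v => mem_ordering v sE).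
rewrite (bigID (mem W)) /= addrAC subrr add0r.
rewrite (eq_bigl (mem (~: W))) => [|v]; last by rewrite /= inE.
apply: le_trans (ler_norm _) (le_trans (sum_le_norm2 _ _) _).
by rewrite ler_wpM2l ?sqrtr_ge0 ?greedy_norm.
Qed.

(** A greedy point for f_m differs from the one for f with the same ordering by the
    increment of f_m - f along the ordering, which is m, 0, - f(V) or
    - f(V) - m; all four are bounded by sqrt(n) L, because 0 <= m <= - f(W) and
    0 <= f(V) + m <= f(V) - f(W). *)
Lemma generator_entry mu W g v : mu = - f W -> generator f mu g ->
  `|g v| <= (1 + Num.sqrt n%:R) * L.
Proof.
move=> muE [m [s [[m0 mT] mm sE ->]]].
have := entry_le_norm2 (greedy_point f s) v; rewrite !ffunE.
have := greedy_norm sE.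
set X1 := [set u in take _.+1 s]; set X0 := [set u in take _ s].
have us := ordering_uniq sE; have vs := mem_ordering v sE.
have X1n : X1 != set0.
  by apply/set0Pn; exists v; rewrite /X1 set_takeS // !inE eqxx.
have X0n : X0 != setT.
  apply/eqP => /setP/(_ v); rewrite !inE => h.
  by have := notin_take_index us vs; rewrite h.
have := abs_value_le W; have := abs_value_le setT; have := covalue_le W.
rewrite /shift (negbTE X1n) (negbTE X0n) orbF /= => h1.
rewrite !ler_norml mulrDl mul1r => /andP[h2 h3] /andP[h4 h5] h6 /andP[h7 h8].
set k := Num.sqrt _ * L in h1 h2 h3 h4 h5 *.
have mk : m <= k by lra.
case: (eqVneq X0 set0) h7 h8 => [->|_]; case: (eqVneq X1 setT) => [->|_];
  rewrite ?f0 => h7 h8; apply/andP; split; lra.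
Qed.

(** The points 1_S +- G^-1 e_i belong to the polar cone.  By the parallelogram law
    for both norms, their sum of squared A-norms is
    2 (1_S.A 1_S + G^-2 A_ii), while the Euclidean one is 2 (|S| + G^-2). *)
Lemma diagonal_bound mu W S (A : 'M[R]_n) G i : posdef A -> admissible f mu ->
  mu = - f W -> f S <= f W - 1 ->
  (forall p, polar_cone f mu p -> bilin A p p <= bilin 1%:M p p) ->
  0 < G -> (forall g v, generator f mu g -> `|g v| <= G) ->
  A i i <= 1 + #|S|%:R * G ^+ 2.
Proof.
move=> Ap adm muE SW coneA G0 gG.
have SW' : f S < f W by lra.
pose d : 'cV[R]_n := delta_mx i 0; pose p := colv (indicator R S).
have dg g : bilin 1%:M d (colv g) = g (enum_val i).
  by rewrite /bilin mulmx1 trmx_delta -rowE !mxE.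
have dA (B : 'M[R]_n) : bilin B d d = B i i.
  by rewrite /bilin trmx_delta -rowE -colE !mxE.
have pp : bilin 1%:M p p = #|S|%:R.
  rewrite bilin1_colv -sum1_card natr_sum [RHS]big_mkcond; apply: eq_bigr => v _.
  by rewrite !ffunE; case: (v \in S); rewrite ?mulr1 ?mulr0.
have conep (c : R) : `|c| <= G^-1 -> polar_cone f mu (p + c *: d).
  move=> cG g gg; rewrite bilinDl bilinZl dg /p bilin1_indicator.
  have := improving_generator fsub f0 adm muE SW' gg.
  have : c * g (enum_val i) <= 1.
    apply: le_trans (ler_norm _) _; rewrite normrM -(mulVf (lt0r_neq0 G0)).
    by rewrite ler_pM // gG.
  lra.
have r0 : 0 < G^-1 by rewrite invr_gt0.
have c1 : `|G^-1| <= G^-1 by rewrite gtr0_norm.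
have c2 : `|- G^-1| <= G^-1 by rewrite normrN.
have h1 := coneA _ (conep _ c1); have h2 := coneA _ (conep _ c2).
have A0 := posdef_ge0 p Ap.
move: h1 h2; rewrite !(bilinDl, bilinDr, bilinZl, bilinZr) !dA pp !mxE eqxx.
set x := bilin A p d; set y := bilin A d p; set x' := bilin 1%:M p d; set y' := bilin 1%:M d p.
have -> : true%:R = 1 :> R by [].
move=> h1 h2.
have h : G^-1 ^+ 2 * A i i <= #|S|%:R + G^-1 ^+ 2 by move: h1 h2 A0; set c := G^-1; lra.
have e : G ^+ 2 * G^-1 ^+ 2 = 1 by rewrite -exprMn mulfV ?expr1n ?lt0r_neq0.
have := ler_wpM2l (sqr_ge0 G) h.
by rewrite mulrDr mulrA e mul1r mulrC addrC.
Qed.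
End Bounds.

Section Conclusion.
Variables (R : realType) (V : finType) (fi : {set V} -> int) (L : R).
Let f (S : {set V}) : R := (fi S)%:~R.
Hypotheses (fsub : submodular fi) (f0 : fi set0 = 0) (Lmax : is_max_norm2 f L).
Hypothesis V0 : (0 < #|V|)%N.
Local Notation n := #|V|.

Lemma real_submodular : submodular f.
Proof. by move=> X Y; rewrite /f -!intrD ler_int. Qed.

Lemma real_empty : f set0 = 0. Proof. by rewrite /f f0. Qed.

(** A greedy point is integral, so a nonzero one has norm at least 1. *)
Lemma max_norm_ge1 S : fi S != 0 -> 1 <= L.
Proof.
move=> S0; have [s sE zS] := tight_ordering real_empty S.
have [v v0] : exists v, greedy_point f s v != 0.
  apply/existsP; apply: contraR S0; rewrite negb_exists => /forallP z0.
  have : f S = 0 by rewrite -zS big1 // => v _; apply/eqP; move: (z0 v); rewrite negbK.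
  by move/eqP; rewrite intr_eq0.
apply: le_trans (greedy_norm real_submodular real_empty Lmax sE).
apply: le_trans (entry_le_norm2 _ v); move: v0; rewrite ffunE /f -intrB intr_eq0.
by rewrite -intr_norm -[1]/(1%:~R) ler_int => h; rewrite -gtz0_ge1 normr_gt0.
Qed.

(** The entry bound is G = (1 + sqrt n) L and a proper set S has at most n - 1
    elements, so A_ii <= 1 + (n - 1) (2 + 2 n) L^2 <= 2 (n L)^2 <= (n L)^3; the last
    two inequalities use L >= 1 and n L >= 2. *)
Lemma improving_bounds (A : 'M[R]_n) mu t W S : loop_inv f t A mu W ->
  f S < f W -> [/\ (1 < n)%N, 1 <= L & (9 / 5) ^+ t <= (n%:R * L) ^+ (3 * n)].
Proof.
move=> inv SW; have [Ap muE adm icone idet] := inv.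
have [S0 ST] := improving_proper real_empty adm muE SW.
have Sn : (#|S| < n)%N by rewrite -cardsT proper_card // properT.
have S1 : (0 < #|S|)%N by rewrite card_gt0.
have n1 : (1 < n)%N by apply: leq_ltn_trans Sn.
have fW0 : f W <= 0 by rewrite -oppr_ge0 -muE; case: adm.
have L1 : 1 <= L.
  apply: (@max_norm_ge1 S); have : f S < 0 by exact: lt_le_trans SW fW0.
  by rewrite /f ltrz0 => /lt_eqF ->.
(* The values of f are integers. *)
have SW1 : f S <= f W - 1.
  by move: SW; rewrite /f -[1]/(1%:~R) -intrB ltr_int ler_int; lia.
split=> //; apply: le_trans (idet _ SW) _; apply: le_trans (det_le_diag Ap) _.
pose s : R := Num.sqrt n%:R; pose G := (1 + s) * L.
have s2 : s ^+ 2 = n%:R by rewrite sqr_sqrtr.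
have s0 : 0 <= s by exact: sqrtr_ge0.
have G0 : 0 < G by rewrite mulr_gt0 //; lra.
have n2 : 2 <= n%:R :> R by rewrite (ler_nat R 2).
have x2 : 2 <= n%:R * L by rewrite -[2]mulr1 ler_pM.
have -> : (n%:R * L) ^+ (3 * n) = \prod_(i < n) (n%:R * L) ^+ 3.
  by rewrite prodr_const card_ord exprM.
apply: ler_prod => i _.
(* Each factor of Hadamard's bound is at most (n L)^3. *)
have diag := diagonal_bound real_submodular real_empty i Ap adm muE SW1 icone G0
  (fun g v => generator_entry real_submodular real_empty Lmax v muE).
apply/andP; split.
  have := Ap.2 (delta_mx i 0); rewrite /bilin trmx_delta -rowE -colE !mxE => h.
  apply/ltW/h/eqP => /matrixP/(_ i 0); rewrite !mxE !eqxx => /eqP.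
  by rewrite oner_eq0.
apply: le_trans diag _.
have h1 : #|S|%:R <= n%:R - 1 :> R.
  by rewrite lerBrDr natr1 ler_nat.
have h2 : (1 + s) ^+ 2 <= 2 + 2 * n%:R.
  rewrite -s2; have : 0 <= (1 - s) ^+ 2 by exact: sqr_ge0.
  by rewrite !expr2; nra.
have h3 : #|S|%:R * (1 + s) ^+ 2 <= (n%:R - 1) * (2 + 2 * n%:R).
  by apply: ler_pM => //; rewrite sqr_ge0.
have L2 : 1 <= L ^+ 2 by rewrite exprn_ege1.
have h4 : #|S|%:R * G ^+ 2 <= (n%:R - 1) * (2 + 2 * n%:R) * L ^+ 2.
  by rewrite /G exprMn mulrA ler_wpM2r // sqr_ge0.
have h5 : 2 * (n%:R * L) ^+ 2 <= (n%:R * L) ^+ 3.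
  by rewrite [in leRHS]exprS ler_wpM2r // sqr_ge0.
apply: le_trans h5; have -> : (n%:R * L) ^+ 2 = n%:R ^+ 2 * L ^+ 2 by rewrite exprMn.
set X := _ * G ^+ 2 in h4 *; lra.
Qed.

Lemma log2_ge1 (x : R) : 1 <= log2 x.
Proof.
have l2 : 0 < ln 2 :> R by rewrite ln_gt0 // ltr1n.
rewrite /log2 ler_pdivlMr // mul1r ler_ln ?posrE //; first by rewrite le_max lexx.
by rewrite lt_max ltr0n.
Qed.

(** Since n log(n L) >= 2, rounding down leaves T > 4 n log(n L); and
    (9/5)^4 >= 2^3. *)
Lemma rounds_suffice : (1 < n)%N -> 1 <= L ->
  (n%:R * L) ^+ (3 * n) < (9 / 5) ^+ (rounds n L).
Proof.
move=> n1 L1; have n2 : 2 <= n%:R :> R by rewrite (ler_nat R 2).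
have x2 : 2 <= n%:R * L by rewrite -[2]mulr1 ler_pM.
have lg1 := log2_ge1 (n%:R * L).
have l2 : 0 < ln 2 :> R by rewrite ln_gt0 // ltr1n.
have lx : ln (n%:R * L) = log2 (n%:R * L) * ln 2.
  by rewrite /log2 (max_idPr x2) divfK // gt_eqF.
have x0 : 0 < n%:R * L by lra.
have T0 : 0 <= 5 * n%:R * log2 (n%:R * L).
  by apply: mulr_ge0; [exact: mulr_ge0 | exact: le_trans ler01 lg1].
have := truncn_itv T0; rewrite -/(rounds n L) => /andP[_].
set T := rounds n L; rewrite -[T.+1%:R]natr1 => TT.
have T4 : 4 * n%:R * log2 (n%:R * L) < T%:R.
  have : 2 <= n%:R * log2 (n%:R * L) by rewrite -[2]mulr1 ler_pM.
  move: TT; rewrite -!mulrA; lra.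
have l95 : 3 * ln 2 <= 4 * ln (9 / 5) :> R.
  have e k (x : R) : 0 < x -> k%:R * ln x = ln (x ^+ k).
    by move=> x00; rewrite lnXn // mulr_natl.
  rewrite (e 3) // (e 4) ?divr_gt0 // ler_ln ?posrE ?exprn_gt0 ?divr_gt0 //.
  lra.
have q0 : 0 < 9 / 5 :> R by rewrite divr_gt0.
suff : ln ((n%:R * L) ^+ (3 * n)) < ln ((9 / 5) ^+ T) :> R.
  by rewrite ltr_ln ?posrE ?exprn_gt0.
rewrite (lnXn _ x0) (lnXn _ q0) -!(mulr_natl (ln _)) natrM lx.
have h : 0 < (T%:R - 4 * n%:R * log2 (n%:R * L)) * ln 2.
  by rewrite mulr_gt0 // subr_gt0.
have h' : 0 <= T%:R * (4 * ln (9 / 5) - 3 * ln 2) :> R by rewrite mulr_ge0 // subr_ge0.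
nra.
Qed.

Lemma minimizer_of_loop_inv (A : 'M[R]_n) mu W : loop_inv f (rounds n L) A mu W ->
  minimizer f W.
Proof.
move=> inv S; rewrite leNgt; apply/negP => SW.
have [n1 L1] := improving_bounds inv SW.
by rewrite leNgt rounds_suffice.
Qed.

Lemma runs_rescaling_sfm T :
  runs f (rescaling_sfm R V (400 * n * n) T)
    (n * n + 5 + T * (500 * 410 * n ^ 4)).+3 (T * (2500 * n ^ 3)).+1
    (fun W => minimizer f W \/ exists A mu, loop_inv f T A mu W).
Proof.
do 3 apply: runs_bind_compute; rewrite ![eval _]/=; set e := _ / _.
have n0 : 0 < n%:R :> R by rewrite ltr0n.
have eE : e = (20 * n%:R)^-1 by rewrite /e natrM div1r.
have e0 : 0 < e by rewrite eE invr_gt0 mulr_gt0.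
have ne : n%:R * e = 20^-1 by rewrite eE invfM mulrCA mulfV ?mulr1 // gt_eqF.
apply: (runs_bind_le (t2 := (T * (500 * 410 * n ^ 4)).+4) (q2 := (T * (2500 * n ^ 3)).+1)
  (runs_identity f)) => [||Q QE]; [lia|lia|].
apply: runs_bind_compute; apply: runs_bind_query; apply: runs_bind_leq; apply: runs_bind_compute.
rewrite ![eval _]/= sub0r.
set mu := if _ then _ else _; set W := if _ then _ else _.
have inv : loop_inv f 0 (mxV Q) mu W.
  have muE : mu = - f W by rewrite /mu /W; case: ifP; rewrite ?real_empty ?oppr0.
  have adm : admissible f mu.
    rewrite /admissible /mu; by case: (leP 0 (f setT)) => h; split; move: h; lra.
  split=> //; rewrite QE; [exact: posdef1 | by [] | by rewrite expr0 det1].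
apply: runs_weaken
  (runs_rescaling_loop real_submodular real_empty V0 T [::] e0 ne inv _) _ _ _ => //.
by rewrite QE invmx1.
Qed.
End Conclusion.

Theorem theorem3p6 (R : realType) :
  exists C : nat,
    forall (V : finType) (f : {set V} -> int) (L EO : R),
      (0 < #|V|)%N ->
      submodular f ->
      f set0 = 0 ->
      is_max_norm2 (fun S : {set V} => (f S)%:~R : R) L ->
      0 <= EO ->
      exists fuel : nat,
        always (fun S : {set V} => (f S)%:~R : R)
          (rescaling_sfm R V fuel (rounds #|V| L))
          (fun (W : {set V}) (t q : nat) =>
             (forall S : {set V}, f W <= f S) /\
             t%:R + q%:R * EO <=
               C%:R * ((#|V|%:R ^+ 4 * EO + #|V|%:R ^+ 5)
                        * log2 (#|V|%:R * L))).
Proof.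
exists (500 * 410 * 6)%N => V f L EO V0 fsub f0 Lmax EO0.
exists (400 * #|V| * #|V|)%N.
apply: always_impl (runs_rescaling_sfm R fsub f0 V0 (rounds #|V| L)).
move=> W t q [Wopt tT qT]; split.
  have {}Wopt : minimizer (fun S => (f S)%:~R : R) W.
    by case: Wopt => // -[A [mu]]; apply: minimizer_of_loop_inv.
  by move=> S; have := Wopt S; rewrite ler_int.
set T := rounds _ _ in tT qT; set l := log2 _; set n := #|V| in T tT qT l *.
have l1 : 1 <= l by exact: log2_ge1.
have n1 : 1 <= n%:R :> R by rewrite ler1n.
have Tl : T%:R <= 5 * n%:R * l.
  rewrite truncn_le //; apply: mulr_ge0; first exact: mulr_ge0.
  exact: le_trans ler01 l1.
have {}tT : t%:R <= n%:R * n%:R + 8 + T%:R * ((500 * 410) * n%:R ^+ 4) :> R.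
  by rewrite -natrX -!(natrM, natrD) ler_nat; lia.
have {}qT : q%:R <= 1 + T%:R * (2500 * n%:R ^+ 3) :> R.
  by rewrite -natrX -!(natrM, natrD) -(natrD _ 1) ler_nat add1n.
have CE : (500 * 410 * 6)%:R = (500 * 410) * 6 :> R by rewrite !natrM.
rewrite CE; move: (T%:R : R) (t%:R : R) (q%:R : R) Tl tT qT => T' t' q' Tl tT qT.
set N := n%:R in n1 Tl tT qT *.
have N3 : 0 <= N ^+ 3 by rewrite exprn_ge0 // (le_trans ler01).
have N4 : 1 <= N ^+ 4 by exact: exprn_ege1.
have N5 : N ^+ 4 <= N ^+ 5 by rewrite [in leRHS]exprS ler_peMl // (le_trans ler01).
have N2 : N * N <= N ^+ 4.
  by rewrite -expr2 ler_weXn2l.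
have hl (x : R) : 0 <= x -> x <= x * l by move=> x0; rewrite ler_peMr.
have tb : t' <= (500 * 410) * 6 * (N ^+ 5 * l).
  have h1 : T' * N ^+ 4 <= 5 * (N ^+ 5 * l).
    have := ler_wpM2r (le_trans ler01 N4) Tl.
    by rewrite (_ : 5 * N * l * N ^+ 4 = 5 * (N ^+ 5 * l)) //; ring.
  have h2 := hl (N ^+ 5) (le_trans ler01 (le_trans N4 N5)).
  move: tT; rewrite mulrCA; lra.
have qb : q' <= (500 * 410) * 6 * (N ^+ 4 * l).
  have h1 : T' * N ^+ 3 <= 5 * (N ^+ 4 * l).
    have := ler_wpM2r N3 Tl.
    by rewrite (_ : 5 * N * l * N ^+ 3 = 5 * (N ^+ 4 * l)) //; ring.
  have h2 := hl (N ^+ 4) (le_trans ler01 N4).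
  move: qT; rewrite mulrCA; lra.
have := ler_wpM2r EO0 qb; move: tb.
rewrite (_ : (500 * 410) * 6 * ((N ^+ 4 * EO + N ^+ 5) * l) =
  (500 * 410) * 6 * (N ^+ 5 * l) + (500 * 410) * 6 * (N ^+ 4 * l) * EO); last by ring.
by move=> h1 h2; exact: lerD h1 h2.
Qed.
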